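(* Let $m>1$ be an integer, let $k$ be a field, let $S=k[x_1,\ldots,x_n]$, let $\Delta$ be a pure simplicial complex on $[n]=\{1,\ldots,n\}$ with $\dim\Delta=1$, and let $I=I_\Delta\subset S$ be its Stanley-Reisner ideal. Then: (1) $S/I^{(m)}$ is clean if and only if $S/I^{(m)}$ is Cohen-Macaulay, where $I^{(m)}$ is the $m$-th symbolic power of $I$; (2) $S/I^{m}$ is clean if and only if $S/I^{m}$ is Cohen-Macaulay, where $I^m$ is the ordinary $m$-th power of $I$.
   Context: A simplicial complex $\Delta$ on $[n]$ is a collection of subsets of $[n]$ (called faces) closed under taking subsets; its maximal faces under inclusion are called facets. The dimension of a face $F$ is $|F|-1$, and $\dim\Delta$ is the maximum of the dimensions of its facets. $\Delta$ is pure if all its facets have the same dimension. The Stanley-Reisner ideal of $\Delta$ is $I_\Delta=(\prod_{i\in F}x_i : F\subseteq[n],\ F\notin\Delta)\subset S$. For $F\subseteq [n]$ put $P_F=(x_i : i\in F)$. Then $I_\Delta=\bigcap_{G} P_{[n]\setminus G}$, where $G$ runs over the facets of $\Delta$, and the $m$-th symbolic power is $I_\Delta^{(m)}=\bigcap_{G} P_{[n]\setminus G}^m$, with $G$ again running over the facets of $\Delta$. For a monomial ideal $I\subset S$, a prime filtration of $S/I$ is a chain of monomial ideals $\mathcal F: I=I_0\subset I_1\subset\cdots\subset I_r=S$ such that for each $i=1,\ldots,r$ there is a monomial prime ideal $\mathfrak p_i$ of $S$ with $I_i/I_{i-1}\cong S/\mathfrak p_i$. Put $\operatorname{Supp}\mathcal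 F=\{\mathfrak p_1,\ldots,\mathfrak p_r\}$. The filtration is clean if $\operatorname{Supp}\mathcal F$ equals the set $\operatorname{Min} I$ of minimal primes of $I$. $S/I$ is called clean if it admits a clean prime filtration. *)

(* Defs.v *)
From HB Require Import structures.
From mathcomp Require Import all_boot all_order all_algebra.
From mathcomp Require Import boolp classical_sets.
From mathcomp Require Import mpoly.

Set Implicit Arguments.
Unset Strict Implicit.
Unset Printing Implicit Defensive.

Import GRing.Theory.
Local Open Scope classical_set_scope.
Local Open Scope ring_scope.

Section Ideals.
Context {R : comNzRingType}.
Implicit Types (I J M N P : set R).

Definition is_ideal J : Prop :=
  [/\ J 0, (forall a b, J a -> J b -> J (a + b))
    & (forall r a, J a -> J (r * a))].

Definition ideal_gen (A : set R) : set R :=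
  \bigcap_(J in [set J | is_ideal J /\ A `<=` J]) J.

Definition ideal_mul I J : set R :=
  ideal_gen [set f * g | f in I & g in J].

Definition ideal_pow I (m : nat) : set R := iter m (ideal_mul I) setT.

Definition prime_ideal P : Prop :=
  [/\ is_ideal P, ~ P 1 & forall a b, P (a * b) -> P a \/ P b].

Definition min_primes J : set (set R) :=
  [set P | [/\ prime_ideal P, J `<=` P
    & forall Q, prime_ideal Q -> J `<=` Q -> Q `<=` P -> Q = P]].

(* An isomorphism M/N -> M'/N' of R-modules, for ideals N `<=` M and
   N' `<=` M' of R, given by a map phi on representatives.  Together with
   additivity, [N a <-> N' (phi a)] says that the induced map on classes is
   well defined (left to right) and injective (right to left). *)
Definition subquot_iso M N M' N' : Prop :=
  exists phi : R -> R,
    [/\ forall a, M a -> M' (phi a),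
        forall a b, M a -> M b -> N' (phi (a + b) - (phi a + phi b)),
        forall r a, M a -> N' (phi (r * a) - r * phi a),
        forall a, M a -> (N a <-> N' (phi a))
      & forall b, M' b -> exists2 a, M a & N' (b - phi a)].

(* Primes of R/J are identified with the primes of R containing J. *)
Definition quot_prime_chain J (d : nat) : Prop :=
  exists P : nat -> set R,
    (forall i, (i <= d)%N -> prime_ideal (P i) /\ J `<=` P i) /\
    (forall i, (i < d)%N -> P i `<` P i.+1).

Definition quot_krull_dim J (d : nat) : Prop :=
  quot_prime_chain J d /\ forall e, quot_prime_chain J e -> (e <= d)%N.

(* s, a sequence of elements of M, is a regular sequence on R/J: each s_i is
   a nonzerodivisor on R/(J + (s_0, ..., s_(i-1))), and R/(J + (s)) != 0. *)
Definition quot_regular_seq M J (s : seq R) : Prop :=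
  [/\ forall f, f \in s -> M f,
      forall i, (i < size s)%N -> forall g,
        ideal_gen (J `|` [set` take i s]) (s`_i * g) ->
        ideal_gen (J `|` [set` take i s]) g
    & ~ ideal_gen (J `|` [set` s]) 1].

Definition quot_depth M J (d : nat) : Prop :=
  (exists2 s, quot_regular_seq M J s & size s = d) /\
  forall s, quot_regular_seq M J s -> (size s <= d)%N.

End Ideals.

Section MonomialIdeals.
Context {k : fieldType} {n : nat}.
Local Notation S := {mpoly k[n]}.
Implicit Types (I J P : set S).

Definition monomial_ideal J : Prop :=
  exists A : set 'X_{1..n}, J = ideal_gen [set 'X_[a] | a in A].

Definition var_ideal (F : {set 'I_n}) : set S :=
  ideal_gen [set 'X_i | i in [set` F]].

Definition prime_filtration I (r : nat) (C p : nat -> set S) : Prop :=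
  [/\ C 0%N = I, C r = setT,
      forall i, (i <= r)%N -> monomial_ideal (C i)
    & forall i, (i < r)%N ->
        [/\ C i `<=` C i.+1, monomial_ideal (p i), prime_ideal (p i)
          & subquot_iso (C i.+1) (C i) setT (p i)]].

Definition quot_clean I : Prop :=
  exists r C p, prime_filtration I r C p /\
    [set p i | i in [set i | (i < r)%N]] = min_primes I.

(* Cohen-Macaulayness of S/J as a graded ring (J homogeneous):
   depth S/J = dim S/J, the depth being taken with respect to the graded
   maximal ideal (x_1, ..., x_n). *)
Definition quot_cohen_macaulay J : Prop :=
  exists d, quot_krull_dim J d /\ quot_depth (var_ideal [set: 'I_n]) J d.

End MonomialIdeals.

Section Complexes.
Context {n : nat}.
Implicit Types (Delta : {set {set 'I_n}}) (F G : {set 'I_n}).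

Definition simplicial_complex Delta : Prop :=
  forall F G, F \in Delta -> G \subset F -> G \in Delta.

Definition facets Delta : {set {set 'I_n}} :=
  [set F | maxset (fun G => G \in Delta) F].

Definition face_dim F : int := #|F|%:Z - 1.

(* The subtraction is taken outside the maximum, which is over nat; the
   dimension is -1 both for {set0} and for the complex without faces. *)
Definition complex_dim Delta : int := (\max_(F in facets Delta) #|F|)%:Z - 1.

Definition pure_complex Delta : Prop :=
  forall F G, F \in facets Delta -> G \in facets Delta ->
    face_dim F = face_dim G.

Variable k : fieldType.

Definition stanley_reisner Delta : set {mpoly k[n]} :=
  ideal_gen [set \prod_(i in F) 'X_i | F in [set F | F \notin Delta]].

Definition symbolic_power Delta (m : nat) : set {mpoly k[n]} :=
  \bigcap_(G in [set` facets Delta]) ideal_pow (var_ideal (~: G)) m.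

End Complexes.

Arguments stanley_reisner {n} k Delta.
Arguments symbolic_power {n} k Delta m.

(* Main.v *)
Require Import Defs.
From mathcomp Require Import all_boot all_order all_algebra.
From mathcomp Require Import boolp classical_sets.
From mathcomp Require Import mpoly.
From mathcomp Require Import zify ring.

(* The facets of [Delta] are edges.  A monomial [x^a] lies outside
   [J = I^(m)] iff the graph [D_a] of the edges [G] with
   [\sum_(l \notin G) a_l < m] is nonempty.

   Clean => Cohen-Macaulay: the quotients of a clean filtration are the
   [S / P_(~: G)], polynomial rings in two variables on which the elementary
   symmetric polynomials [e_1, e_2] form a regular sequence; so they form one on
   [S / J].  There are only [O(d^2)] monomials of degree at most [d] outside [J],
   so any three polynomials are related modulo [J]; the lexicographically
   lowest term of the relation (Coquand and Lombardi) bounds by 2 both the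
   dimension and the length of regular sequences.

   Cohen-Macaulay => clean: depth 2 makes [H^1] of the Cech complex vanish, so
   every [D_a] is connected.  Hence nonadjacent vertices have a common
   neighbour and, when [m >= 3], every vertex outside an edge is adjacent to one
   of its ends ([Delta] is a matroid).  The pairs [(G, b)], with [b] a monomial
   of degree less than [m] in the variables off [G], index the
   components of [S / J]; they can be ordered, first by [deg b], so that in each
   [D_a] every edge other than the first one meets an earlier edge.  Removing the
   components one at a time, last first, gives a clean filtration.

   Ordinary powers: if [S / I^m] is clean or Cohen-Macaulay then [I^m] has no
   embedded component, so [I^m = I^(m)]. *)

Set Implicit Arguments.
Unset Strict Implicit.
Unset Printing Implicit Defensive.

Import GRing.Theory.
Local Open Scope ring_scope.

(** * Ideals *)

Section IdealTheory.
Local Open Scope classical_set_scope.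
Context {R : comNzRingType}.
Implicit Types (A J : set R).

Lemma ideal_gen_ideal A : is_ideal (ideal_gen A).
Proof.
split=> [J [[J0 _ _] _]|a b aA bA J JA|r a aA J JA]; first exact: J0.
  by case: (JA) => -[_ JD _] _; apply: JD; [apply: aA | apply: bA].
by case: (JA) => -[_ _ JM] _; apply: JM; apply: aA.
Qed.

Lemma sub_ideal_gen A : A `<=` ideal_gen A.
Proof. by move=> a Aa J [_]; apply. Qed.

Lemma ideal_gen_min A J : is_ideal J -> A `<=` J -> ideal_gen A `<=` J.
Proof. by move=> iJ AJ a; apply. Qed.

Lemma ideal_gen_id J : is_ideal J -> ideal_gen J = J.
Proof.
by move=> iJ; apply/seteqP; split; [apply: ideal_gen_min|apply: sub_ideal_gen].
Qed.

Section Operations.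
Variable J : set R.
Hypothesis idJ : is_ideal J.

Lemma ideal0 : J 0. Proof. by case: idJ. Qed.

Lemma idealD a b : J a -> J b -> J (a + b).
Proof. by case: idJ => _ + _; apply. Qed.

Lemma idealMl r a : J a -> J (r * a).
Proof. by case: idJ => _ _; apply. Qed.

Lemma idealMr a r : J a -> J (a * r).
Proof. by rewrite mulrC; apply: idealMl. Qed.

Lemma idealN a : J a -> J (- a).
Proof. by rewrite -mulN1r; apply: idealMl. Qed.

Lemma idealB a b : J a -> J b -> J (a - b).
Proof. by move=> Ja Jb; apply/idealD/idealN. Qed.

Lemma ideal_sum (I : Type) (r : seq I) (P : pred I) (F : I -> R) :
  (forall i, P i -> J (F i)) -> J (\sum_(i <- r | P i) F i).
Proof. by move=> JF; apply: big_ind => //; [apply: ideal0|apply: idealD]. Qed.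

Lemma ideal_sumS (I : eqType) (r : seq I) (F : I -> R) :
  (forall i, i \in r -> J (F i)) -> J (\sum_(i <- r) F i).
Proof. by move=> JF; rewrite big_seq; apply: ideal_sum. Qed.

Lemma ideal_subKl a b : J (a - b) -> J b -> J a.
Proof. by move=> Jab Jb; rewrite -(subrK b a); apply: idealD. Qed.

Lemma ideal_subKr a b : J (a - b) -> J a -> J b.
Proof. by rewrite -(opprB b a) => /idealN; rewrite opprK; apply: ideal_subKl. Qed.

Lemma ideal_adjoin_ideal f : is_ideal [set h | exists t, J (h - t * f)].
Proof.
split=> [|a b [s Js] [t Jt]|r a [t Jt]].
- by exists 0; rewrite mul0r subr0; apply: ideal0.
- exists (s + t); have -> : a + b - (s + t) * f = (a - s * f) + (b - t * f).
    by ring.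
  exact: idealD.
- exists (r * t); have -> : r * a - r * t * f = r * (a - t * f) by ring.
  exact: idealMl.
Qed.

Lemma ideal_adjoinP f h :
  ideal_gen (J `|` [set` [:: f]]) h <-> exists t, J (h - t * f).
Proof.
split=> [|[t Jt]].
  move: h; apply: ideal_gen_min; first exact: ideal_adjoin_ideal.
  move=> a [Ja|/=]; first by exists 0; rewrite mul0r subr0.
  by rewrite inE => /eqP->; exists 1; rewrite mul1r subrr; apply: ideal0.
have [_ gD gM] := ideal_gen_ideal (J `|` [set` [:: f]]).
rewrite -(subrK (t * f) h); apply: gD; first by apply: sub_ideal_gen; left.
by apply: gM; apply: sub_ideal_gen; right; rewrite /= inE.
Qed.

End Operations.

Lemma ideal_adjoin0 J : is_ideal J -> ideal_gen (J `|` [set` [::]]) = J.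
Proof.
move=> iJ; rewrite (_ : [set` [::]] = set0) ?setU0 ?ideal_gen_id //.
by apply/seteqP; split.
Qed.

Lemma prime_idealX (P : set R) a m : prime_ideal P -> P (a ^+ m) -> P a.
Proof.
move=> [_ P1 PM]; elim: m => [|m IHm]; first by rewrite expr0.
by rewrite exprS => /PM[].
Qed.

Lemma prime_ideal_prod (P : set R) (I : Type) (r : seq I) (Q : pred I)
    (x : I -> R) : prime_ideal P -> P (\prod_(i <- r | Q i) x i) ->
  exists2 i, Q i & P (x i).
Proof.
move=> [_ P1 PM]; elim: r => [|i r IHr]; first by rewrite big_nil.
by rewrite big_cons; case: ifP => // Qi /PM[Pi|//]; exists i.
Qed.

(** The isomorphism sends [b] to a chosen [t] with [b = t u] modulo [A]. The choice is unique modulo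
    [(A : u) = P], which makes it linear there. *)
Lemma sub_quot_iso_adjoin (A B P : set R) u : is_ideal A ->
  (forall b, B b <-> exists t, A (b - t * u)) ->
  (forall t, A (t * u) <-> P t) -> subquot_iso B A setT P.
Proof.
move=> iA BP AP.
have /choice[phi phiP] : forall b, exists t, B b -> A (b - t * u).
  by move=> b; have [/BP[t At]|nB] := pselect (B b); [exists t|exists 0].
have iB : is_ideal B.
  by rewrite (_ : B = [set h | exists t, A (h - t * u)]);
    [exact: ideal_adjoin_ideal | apply/seteqP; split => b /BP].
exists phi; split=> // [a b Ba Bb|r a Ba|a Ba|b _].
- apply/AP; have /(idealB iA (idealD iA (phiP _ Ba) (phiP _ Bb))) := phiP _
  (idealD iB Ba Bb).
  by congr A; ring.
- apply/AP; have /(idealB iA (idealMl iA r (phiP _ Ba))) := phiP _ (idealMl iB r Ba).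
  by congr A; ring.
- by rewrite -AP; split => [Aa|Apa]; [apply: (ideal_subKr iA (phiP _ Ba))|
    apply: (ideal_subKl iA (phiP _ Ba))].
- have Bu : B (b * u) by apply/BP; exists b; rewrite subrr; apply: ideal0.
  by exists (b * u) => //; apply/AP; rewrite mulrBl; apply: phiP.
Qed.

End IdealTheory.

(** * Monomial ideals *)

Section MonomialIdealTheory.
Local Open Scope classical_set_scope.
Context {k : fieldType} {n : nat}.
Local Notation S := {mpoly k[n]}.
Implicit Types (U W A : set 'X_{1..n}) (f g : S) (a b : 'X_{1..n}).
Implicit Types (F G : {set 'I_n}).

Definition upward U := forall a b, U a -> U (a + b)%MM.

(** For upward closed [U] this is the monomial ideal spanned by the [x^a] with [a] in [U];
    membership is tested on supports, so ideals turn into sets of exponents. *)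
Definition mideal U : set S := [set f | forall a, a \in msupp f -> U a].

Lemma mideal_ideal U : upward U -> is_ideal (mideal U).
Proof.
move=> upU; split=> [a|f g Uf Ug a|r f Uf a]; first by rewrite msupp0.
  by move=> /msuppD_le; rewrite mem_cat => /orP[/Uf|/Ug].
by move=> /msuppM_le/allpairsP[[b c] /= [_ /Uf Uc ->]]; rewrite addmC; apply: upU.
Qed.

Lemma midealX U a : mideal U 'X_[a] <-> U a.
Proof.
by split=> [|Ua b]; [apply; rewrite msuppX inE | rewrite msuppX inE => /eqP->].
Qed.

Lemma mideal_sub U (J : set S) : is_ideal J -> (forall a, U a -> J 'X_[a]) ->
  mideal U `<=` J.
Proof.
move=> iJ UJ f Uf; rewrite [f]mpolyE; apply: ideal_sumS => // a /Uf Ua.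
by rewrite -mul_mpolyC; apply: idealMl => //; apply: UJ.
Qed.

Lemma gen_mideal U A : upward U -> A `<=` U ->
  (forall a, U a -> exists2 b, A b & (b <= a)%MM) ->
  ideal_gen [set 'X_[a] | a in A] = mideal U :> set S.
Proof.
move=> upU AU UA; apply/seteqP; split.
  apply: ideal_gen_min; first exact: mideal_ideal.
  by move=> _ [a Aa <-]; apply/midealX/AU.
have iA := ideal_gen_ideal ([set 'X_[a] | a in A] : set S).
apply: mideal_sub => // a /UA[b Ab ba].
by rewrite -(submK ba) mpolyXD; apply: (idealMl iA); apply: sub_ideal_gen; exists b.
Qed.

Lemma mideal_monomial U : upward U -> monomial_ideal (mideal U).
Proof. by move=> upU; exists U; rewrite -(@gen_mideal U U) // => a Ua;
  exists a => //; apply: lepm_refl. Qed.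

Definition mset_add U W : set 'X_{1..n} :=
  [set c | exists a b, [/\ U a, W b & c = (a + b)%MM]].

Lemma mset_add_upward U W : upward W -> upward (mset_add U W).
Proof.
move=> upW _ c [a [b [Ua Wb ->]]]; exists a, (b + c)%MM.
by split=> //; [apply: upW | rewrite addmA].
Qed.

Lemma ideal_mul_mideal U W : upward W ->
  ideal_mul (mideal U) (mideal W) = mideal (mset_add U W).
Proof.
move=> upW; have iUW := mideal_ideal (mset_add_upward (U := U) upW).
apply/seteqP; split.
  apply: ideal_gen_min => // _ [f Uf [g Wg <-]] c.
  by move=> /msuppM_le/allpairsP[[a b] /= [/Uf Ua /Wg Wb ->]]; exists a, b.
apply: mideal_sub; first exact: ideal_gen_ideal.
move=> _ [a [b [Ua Wb ->]]]; apply: sub_ideal_gen.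
by exists 'X_[a]; [apply/midealX|exists 'X_[b]; [apply/midealX|rewrite mpolyXD]].
Qed.

Fixpoint mset_pow U m : set 'X_{1..n} :=
  if m is m'.+1 then mset_add U (mset_pow U m') else setT.

Lemma mset_pow_upward U m : upward (mset_pow U m).
Proof. by elim: m => [//|m IHm]; apply: mset_add_upward. Qed.

Lemma ideal_pow_mideal U m : ideal_pow (mideal U) m = mideal (mset_pow U m).
Proof.
elim: m => [|m IHm]; first by apply/seteqP; split.
by rewrite -ideal_mul_mideal -?IHm //; apply: mset_pow_upward.
Qed.

Definition degon F a := (\sum_(i in F) a i)%N.

Lemma degonD F a b : degon F (a + b)%MM = (degon F a + degon F b)%N.
Proof. by rewrite /degon -big_split; apply: eq_bigr => i _; rewrite mnmDE. Qed.

Lemma degon1 F i : degon F U_(i)%MM = (i \in F).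
Proof.
rewrite /degon; case: (boolP (i \in F)) => iF.
  rewrite (bigD1 i) //= mnm1E eqxx big1 // => j /andP[_ ji].
  by rewrite mnm1E eq_sym (negPf ji).
rewrite big1 // => j jF; rewrite mnm1E; case: eqP => // ij.
by rewrite ij jF in iF.
Qed.

Lemma degonMn F a s : degon F (a *+ s)%MM = (degon F a * s)%N.
Proof. by rewrite /degon big_distrl; apply: eq_bigr => i _; rewrite mulmnE. Qed.

Lemma degon_gt0 F a : (0 < degon F a)%N -> exists2 i, i \in F & (0 < a i)%N.
Proof.
move=> Fa; apply/exists_inP; apply: contraTT Fa => /exists_inPn Fa.
by rewrite -leqNgt leqn0 /degon big1 // => i /Fa; rewrite -eqn0Ngt => /eqP.
Qed.

Lemma leq_degon F a i : i \in F -> (a i <= degon F a)%N.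
Proof. by move=> iF; rewrite /degon (bigD1 i) //= leq_addr. Qed.

Lemma degon_up F m : upward [set a | (m <= degon F a)%N].
Proof. by move=> a b /= ma; rewrite degonD (leq_trans ma) ?leq_addr. Qed.

Lemma var_idealE F : var_ideal F = mideal [set a | (1 <= degon F a)%N].
Proof.
rewrite -(@gen_mideal _ [set U_(i)%MM | i in [set` F]]).
- by rewrite /var_ideal; congr ideal_gen; rewrite image_comp.
- exact: degon_up.
- by move=> _ [i /= iF <-]; rewrite degon1 iF.
- move=> a /= /degon_gt0[i iF ai]; exists U_(i)%MM; first by exists i.
  by apply/mnm_lepP => j; rewrite mnm1E; case: eqP => // <-.
Qed.

Lemma mset_pow_degon F m a :
  mset_pow [set a | (1 <= degon F a)%N] m a <-> (m <= degon F a)%N.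
Proof.
elim: m a => [//|m IHm] a /=; split=> [[b [c [/= Fb /IHm Fc ->]]]|Fa].
  by rewrite degonD; lia.
have [i iF ai] := degon_gt0 (leq_ltn_trans (leq0n _) Fa).
have Ua : (U_(i) <= a)%MM.
  by apply/mnm_lepP => j; rewrite mnm1E; case: eqP => // <-.
exists U_(i)%MM, (a - U_(i))%MM; split; first by rewrite /= degon1 iF.
  by apply/IHm; move: Fa; rewrite -{1}(submK Ua) degonD degon1 iF; lia.
by rewrite addmC submK.
Qed.

Lemma var_ideal_pow F m :
  ideal_pow (var_ideal F) m = mideal [set a | (m <= degon F a)%N].
Proof.
rewrite var_idealE ideal_pow_mideal; congr mideal.
by apply/seteqP; split=> a /mset_pow_degon.
Qed.

(** Evaluation killing the variables in [F]. Its kernel is [var_ideal F], which is prime since the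
    target is a domain. *)
Definition restrict F f : S :=
  f \mPo [tuple (if i \in F then 0 else 'X_i) | i < n].

Lemma restrictX F a :
  restrict F 'X_[a] = if degon F a == 0%N then 'X_[a] else 0.
Proof.
rewrite /restrict comp_mpolyX; case: eqP => Fa.
  rewrite [RHS]mpolyXE_id; apply: eq_bigr => i _; rewrite tnth_mktuple.
  case: ifP => // iF; have := leq_degon a iF; rewrite Fa leqn0 => /eqP->.
  by rewrite !expr0.
have [i iF ai] := degon_gt0 (F := F) (a := a) ltac:(lia).
rewrite (bigD1 i) //= tnth_mktuple iF expr0n.
by case: (a i) ai => // ?; rewrite mul0r.
Qed.

Lemma restrictE F f :
  restrict F f = \sum_(a <- msupp f) f@_a *: restrict F 'X_[a].
Proof. by rewrite [in LHS](mpolyE f) /restrict linear_sum;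
  apply: eq_bigr => a _; rewrite linearZ. Qed.

Lemma restrict_var F f : restrict F f = 0 <-> var_ideal F f.
Proof.
rewrite var_idealE; split=> [f0 a af|Ff].
  have : (restrict F f)@_a = 0 by rewrite f0 mcoeff0.
  rewrite restrictE linear_sum /= (bigD1_seq a) ?msupp_uniq //= restrictX.
  rewrite big1 ?addr0 => [|b ba]; last first.
    rewrite linearZ /= restrictX; case: ifP; rewrite ?mcoeff0 ?mulr0 // => _.
    by rewrite mcoeffX (negPf ba) mulr0.
  case: eqP => [_|]; last by lia.
  by rewrite mcoeffZ mcoeffX eqxx mulr1 => /eqP; rewrite mcoeff_eq0 af.
rewrite restrictE big1_seq // => a /= /Ff Fa; rewrite restrictX.
by rewrite -[_ == _]negbK -lt0n Fa scaler0.
Qed.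

Lemma restrictM F : {morph restrict F : f g / f * g}.
Proof. by move=> f g; rewrite /restrict rmorphM. Qed.

Lemma var_ideal_ideal F : is_ideal (var_ideal F : set S).
Proof. exact: ideal_gen_ideal. Qed.

Lemma var_ideal_prime F : prime_ideal (var_ideal F : set S).
Proof.
split; first exact: var_ideal_ideal.
  by move=> /restrict_var/eqP; rewrite /restrict rmorph1 oner_eq0.
move=> f g /restrict_var/eqP; rewrite restrictM mulf_eq0.
by case/orP=> /eqP/restrict_var; [left|right].
Qed.

Lemma var_idealX F a : var_ideal F ('X_[a] : S) <-> (0 < degon F a)%N.
Proof. by rewrite var_idealE midealX. Qed.

Lemma var_ideal_subset F G : var_ideal F `<=` (var_ideal G : set S) <-> F \subset G.
Proof.
split=> [FG|/fintype.subsetP FG].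
  apply/fintype.subsetP => i iF; have : var_ideal F ('X_i : S).
    by apply/var_idealX; rewrite degon1 iF.
  by move=> /FG/var_idealX; rewrite degon1; case: (i \in G).
apply: ideal_gen_min; first exact: var_ideal_ideal.
by move=> _ [i /= iF <-]; apply/var_idealX; rewrite degon1 FG.
Qed.

Lemma var_ideal_monomial F : monomial_ideal (var_ideal F : set S).
Proof. by rewrite var_idealE; apply/mideal_monomial/degon_up. Qed.

End MonomialIdealTheory.

(** * Regular pairs and Cech cocycles *)

Section RegularPair.
Local Open Scope classical_set_scope.
Context {R : comNzRingType}.
Implicit Types (J M : set R) (f g : R).

(** A regular sequence of length 2 on [R / J], with membership in [J + (f)] spelled out. The
    quotient by the pair may vanish, so every pair is regular for the unit ideal; this starts the
    induction along a filtration. *)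
Definition regular_pair J f g : Prop :=
  (forall h, J (f * h) -> J h) /\
  (forall h t, J (g * h - t * f) -> exists t', J (h - t' * f)).

Lemma regular_seq_pair M J s : is_ideal J -> quot_regular_seq M J s ->
  (1 < size s)%N -> exists f g, [/\ M f, M g & regular_pair J f g].
Proof.
move=> iJ [Ms reg _]; case: s Ms reg => [|f [|g s]] // Ms reg _.
exists f, g; split; [by apply: Ms; rewrite inE eqxx| |].
  by apply: Ms; rewrite !inE eqxx orbT.
split=> [h fh|h t ght].
  by have := reg 0%N isT h; rewrite /= ideal_adjoin0 //; apply.
have /= reg1 := reg 1%N isT h.
have /(ideal_adjoinP iJ)/reg1/(ideal_adjoinP iJ) :
  exists u, J (g * h - u * f) by exists t.
by [].
Qed.

(** If [g h = t f^(K+1)] modulo [J], regularity of [g] gives [h = h1 f], and cancelling [f] leaves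
    [g h1 = t f^K], with a smaller exponent. *)
Lemma regular_pairX J f g K L : is_ideal J -> regular_pair J f g ->
  regular_pair J (f ^+ K) (g ^+ L).
Proof.
move=> iJ [regf regg].
have regfX h : J (f ^+ K * h) -> J h.
  elim: K h => [|K IHK] h; first by rewrite mul1r.
  by rewrite exprS -mulrA => /regf/IHK.
have reggX h t : J (g * h - t * f ^+ K) -> exists t', J (h - t' * f ^+ K).
  elim: K {regfX} h t => [|K IHK] h t.
    by exists h; rewrite mulr1 subrr; apply: ideal0.
  rewrite exprSr mulrA => Jgh; have [h1 Jh] := regg _ _ Jgh.
  have /regf/IHK[t' Jh1] : J (f * (g * h1 - t * f ^+ K)).
    by have := idealB iJ Jgh (idealMl iJ g Jh); congr J; ring.
  exists t'; have := idealD iJ Jh (idealMl iJ f Jh1).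
  by congr J; ring.
split=> // h; elim: L h => [|L IHL] h t.
  by rewrite mul1r; exists t.
by rewrite exprSr -mulrA => /IHL[t1 /reggX].
Qed.

Lemma span_ideal (I : finType) (x : I -> R) :
  is_ideal [set h | exists r : I -> R, h = \sum_i r i * x i].
Proof.
split=> [|_ _ [r ->] [s ->]|c _ [r ->]].
- by exists (fun=> 0); rewrite big1 // => i _; rewrite mul0r.
- exists (fun i => r i + s i); rewrite -big_split; apply: eq_bigr => i _.
  by rewrite mulrDl.
- exists (fun i => c * r i); rewrite big_distrr; apply: eq_bigr => i _.
  by rewrite /= mulrA.
Qed.

Lemma ideal_powX J f K : J f -> ideal_pow J K (f ^+ K).
Proof.
move=> Jf; elim: K => [|K IHK] //.
by rewrite exprS; apply: sub_ideal_gen; exists f => //; exists (f ^+ K).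
Qed.

End RegularPair.

Section Cocycles.
Local Open Scope classical_set_scope.
Context {k : fieldType} {n : nat}.
Local Notation S := {mpoly k[n]}.
Implicit Types (U : set 'X_{1..n}) (J : set S) (a : 'X_{1..n}).

(** Pigeonhole: a monomial of degree above [n * N] has some exponent at least [N], so [K = n N + 1]
    works for every [f]. *)
Lemma maximal_idealX (f : S) N : var_ideal [set: 'I_n] f ->
  exists K (r : 'I_n -> S), f ^+ K = \sum_v r v * 'X_[U_(v) *+ N].
Proof.
move=> mf; exists (n * N).+1.
have : ideal_pow (var_ideal [set: 'I_n]) (n * N).+1 (f ^+ (n * N).+1).
  exact: ideal_powX.
rewrite var_ideal_pow; move: (f ^+ _); apply: mideal_sub.
  exact: span_ideal (fun v => 'X_[U_(v) *+ N]).
move=> a /= nNa; have [v Nv] : exists v, (N <= a v)%N.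
  apply/existsP; apply: contraTT nNa => /existsPn aN; rewrite -ltnNge ltnS.
  rewrite -[n in (n * _)%N]card_ord -sum_nat_const /degon.
  rewrite [leqLHS](eq_bigl xpredT); last by move=> i; rewrite inE.
  by apply: leq_sum => i _; rewrite ltnW // ltnNge aN.
exists (fun w => if w == v then 'X_[a - U_(v) *+ N] else 0).
rewrite (bigD1 v) //= eqxx big1 => [|w /negPf->]; last by rewrite mul0r.
rewrite addr0 -mpolyXD submK //.
by apply/mnm_lepP => i; rewrite mulmnE mnm1E; case: eqP => [<-|_]; rewrite ?mul1n.
Qed.

(* Depth at least 2 makes the first local cohomology module vanish; here is
   the resulting exactness of the Cech complex in degree 1, for cocycles with
   denominators [x_v ^ N]. *)
Lemma cocycle_lift J (f g : S) N (y : 'I_n -> S) : is_ideal J ->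
  var_ideal [set: 'I_n] f -> var_ideal [set: 'I_n] g -> regular_pair J f g ->
  (forall v w, J ('X_[U_(v) *+ N] * y w - 'X_[U_(w) *+ N] * y v)) ->
  exists z, forall v, J ('X_[U_(v) *+ N] * z - y v).
Proof.
move=> iJ /(maximal_idealX N)[K [r fE]] /(maximal_idealX N)[L [s gE]].
move=> /(regular_pairX K L iJ)[regf regg] yJ.
(* For a solution [z], [comb c] would be [(\sum_v c v x_v^N) z] modulo [J]; thus [comb r] stands for
   [f^K z] and [comb s] for [g^L z]. *)
pose comb (c : 'I_n -> S) := \sum_v c v * y v.
have combE c w : J ((\sum_v c v * 'X_[U_(v) *+ N]) * y w - 'X_[U_(w) *+ N] * comb c).
  rewrite big_distrl big_distrr /= -sumrB; apply: ideal_sum => // v _.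
  by have := idealMl iJ (c v) (yJ v w); congr J; ring.
(* This is [g^L (f^K z) = f^K (g^L z)]; regularity then divides [comb r] by [f^K]. *)
have : J (g ^+ L * comb r - comb s * f ^+ K).
  have -> : g ^+ L * comb r = \sum_w r w * (g ^+ L * y w).
    by rewrite big_distrr; apply: eq_bigr => w _ /=; ring.
  rewrite fE big_distrr -sumrB; apply: ideal_sum => // w _.
  have := idealMl iJ (r w) (combE s w); rewrite -gE.
  by congr J => /=; ring.
move=> /regg[z Jz]; exists z => w; apply: regf.
have := idealB iJ (combE r w) (idealMl iJ 'X_[U_(w) *+ N] (idealN iJ Jz)).
move=> /(idealN iJ); rewrite -fE; congr J; ring.
Qed.

Lemma mideal_coef0 U (f : S) a : mideal U f -> ~ U a -> f@_a = 0.
Proof.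
by move=> Uf nUa; apply/eqP; rewrite mcoeff_eq0; apply/negP => /Uf.
Qed.

Lemma mcoeff_XnM v N (z : S) a : ('X_[U_(v) *+ N] * z)@_(U_(v) *+ N + a) = z@_a.
Proof. by rewrite mulrC mcoeffMX. Qed.

Lemma mcoeff_XnM_lt v N (z : S) a : (a v < N)%N -> ('X_[U_(v) *+ N] * z)@_a = 0.
Proof.
move=> avN; apply: (@mideal_coef0 [set b | (N <= b v)%N]); last by rewrite /=; lia.
have iN : is_ideal (mideal [set b : 'X_{1..n} | (N <= b v)%N] : set S).
  by apply: mideal_ideal => b c /=; rewrite mnmDE; lia.
by apply: (idealMr iN); apply/midealX; rewrite /= mulmnE mnm1E eqxx mul1n.
Qed.

End Cocycles.

(** * Consequences of depth two *)

Section EdgeIdeals.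
Local Open Scope set_scope.
Context {k : fieldType} {n : nat}.
Local Notation S := {mpoly k[n]}.
Implicit Types (U W : set 'X_{1..n}) (J : set S) (a : 'X_{1..n}).
Implicit Types (F G : {set 'I_n}) (v w : 'I_n).

Variable E : {set {set 'I_n}}.
Hypothesis card_edge : forall G, G \in E -> #|G| = 2%N.

Definition adj v w := [set v; w] \in E.

Lemma adj_sym v w : adj v w = adj w v.
Proof. by rewrite /adj finset.setUC. Qed.

Lemma adj_neq v w : adj v w -> v != w.
Proof. by move=> /card_edge; rewrite cards2; case: eqP. Qed.

Lemma edgeE G v w : G \in E -> v \in G -> w \in G -> v != w -> G = [set v; w].
Proof.
move=> /card_edge G2 vG wG vw; apply/esym/eqP; rewrite eqEcard G2 cards2 vw /=.
by rewrite andbT; apply/fintype.subsetP => u; rewrite !inE => /orP[]/eqP->.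
Qed.

Lemma edge_adj G v w : G \in E -> v \in G -> w \in G -> v != w -> adj v w.
Proof. by move=> GE vG wG vw; rewrite /adj -(edgeE GE vG wG vw). Qed.

Lemma edge_pair G v : G \in E -> v \in G -> exists2 w, G = [set v; w] & adj v w.
Proof.
move=> GE vG; have : (0 < #|G :\ v|)%N.
  by have := cardsD1 v G; rewrite vG (card_edge GE) add1n => -[<-].
move=> /card_gt0P[w]; rewrite !inE => /andP[wv wG].
by exists w; [apply: edgeE|apply: (edge_adj GE)]; rewrite // eq_sym.
Qed.

Lemma edge_ends G : G \in E -> exists v w, G = [set v; w] /\ adj v w.
Proof.
move=> GE; have /card_gt0P[v vG] : (0 < #|G|)%N by rewrite card_edge.
by have [w GE' vw] := edge_pair GE vG; exists v, w.
Qed.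

Definition symb m : set 'X_{1..n} :=
  [set a | forall G, G \in E -> (m <= degon (~: G) a)%N]%classic.

Lemma symb_up m : upward (symb m).
Proof. by move=> a b Ua G GE; apply/degon_up/Ua. Qed.

Definition vertex v := exists2 G, G \in E & v \in G.

Lemma adj_vertex v w : adj v w -> vertex v.
Proof. by move=> vw; exists [set v; w] => //; rewrite !inE eqxx. Qed.

Section CohenMacaulay.
Variables (m : nat) (f g : S).
Hypotheses (mf : var_ideal [set: 'I_n] f) (mg : var_ideal [set: 'I_n] g).

(** The family equal to [x^a] at [v] and to 0 elsewhere is a cocycle modulo [mideal W]. A lift [z]
    would give [x_v^N z = x^a] modulo [mideal W], but [a v < N] makes the coefficient of [x^a] on
    the left vanish. *)
Lemma regular_pair_no_socle W v N a : upward W -> regular_pair (mideal W) f g ->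
  ~ W a -> (a v < N)%N -> (forall w, w != v -> W (a + U_(w) *+ N)%MM) -> False.
Proof.
move=> upW regW nWa avN Wa; have iW := mideal_ideal (k := k) upW.
pose y w : S := if w == v then 'X_[a] else 0.
have [u w|z /(_ v)] := cocycle_lift (N := N) (y := y) iW mf mg regW.
  have X w0 : w0 != v -> mideal W ('X_[U_(w0) *+ N] * 'X_[a] : S).
    by move=> w0v; rewrite -mpolyXD addmC; apply/midealX/Wa.
  rewrite /y; case: (eqVneq w v) => [->|wv]; case: (eqVneq u v) => [->|uv].
  - by rewrite subrr; apply: ideal0.
  - by rewrite mulr0 subr0; apply: X.
  - by rewrite mulr0 sub0r; apply: (idealN iW); apply: X.
  - by rewrite !mulr0 subr0; apply: ideal0.
rewrite /y eqxx => /mideal_coef0/(_ nWa)/eqP.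
by rewrite mcoeffB mcoeff_XnM_lt // mcoeffX eqxx sub0r oppr_eq0 oner_eq0.
Qed.

Hypothesis regJ : regular_pair (mideal (symb m)) f g.

(** A set [C] closed under the edges of [D_a] gives a cocycle: [x_v^m x^a] for [v] in [C], 0 for the
    others. The coefficient at [a] of a lift is 1 when read at a vertex of [D_a] in [C] and 0 when
    read at one outside [C]. *)
Lemma degree_complex_connected a (C : {set 'I_n}) v1 v2 G1 G2 :
  (forall G v w, G \in E -> (degon (~: G) a < m)%N ->
     v \in G -> w \in G -> v \in C -> w \in C) ->
  G1 \in E -> (degon (~: G1) a < m)%N -> v1 \in G1 -> v1 \in C ->
  G2 \in E -> (degon (~: G2) a < m)%N -> v2 \in G2 -> v2 \in C.
Proof.
move=> closedC G1E G1a v1G v1C G2E G2a v2G; apply/negPn/negP => v2C.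
pose xa v : 'X_{1..n} := (U_(v) *+ m + a)%MM.
pose y v : S := if v \in C then 'X_[xa v] else 0.
have iJ := mideal_ideal (k := k) (@symb_up m).
have [u w|z Jz] := cocycle_lift (N := m) (y := y) iJ mf mg regJ.
  (* An edge keeping this monomial outside [J] would contain both [v0] and [w0] and lie in [D_a],
     against [closedC]. *)
  have X v0 w0 : v0 \notin C -> w0 \in C -> 
      mideal (symb m) ('X_[U_(v0) *+ m] * 'X_[xa w0] : S).
    move=> v0C w0C; rewrite -mpolyXD; apply/midealX => G GE.
    rewrite !degonD !degonMn !degon1 !finset.in_setC.
    case: (boolP (v0 \in G)) => v0G /=; last by clear; lia.
    case: (boolP (w0 \in G)) => w0G /=; last by clear; lia.
    case: (leqP m (degon (~: G) a)) => [|Ga]; first by clear; lia.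
    by rewrite (closedC _ _ _ GE Ga w0G v0G w0C) in v0C.
  rewrite /y; case: ifP => wC; case: ifP => uC.
  - have -> : 'X_[U_(u) *+ m] * 'X_[xa w] = 'X_[U_(w) *+ m] * 'X_[xa u] :> S.
      by rewrite -!mpolyXD; congr 'X_[_]; rewrite /xa !addmA [X in (X + _)%MM]addmC.
    by rewrite subrr; apply: ideal0.
  - by rewrite mulr0 subr0; apply: X => //; rewrite uC.
  - by rewrite mulr0 sub0r; apply: (idealN iJ); apply: X => //; rewrite wC.
  - by rewrite !mulr0 subr0; apply: ideal0.
have coef G v : G \in E -> (degon (~: G) a < m)%N -> v \in G ->
    z@_a = (y v)@_(xa v).
  move=> GE Ga vG; have nU : ~ symb m (xa v).
    by move=> /(_ _ GE); rewrite degonD degonMn degon1 finset.in_setC vG;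
      move: Ga; clear; lia.
  by have := mideal_coef0 (Jz v) nU; rewrite mcoeffB mcoeff_XnM => /eqP;
    rewrite subr_eq0 => /eqP.
have := coef _ _ G1E G1a v1G; rewrite (coef _ _ G2E G2a v2G) /y v1C (negPf v2C).
by rewrite mcoeff0 mcoeffX eqxx => /esym/eqP; rewrite oner_eq0.
Qed.

(** For [x^a = (x_i x_l)^(m-1)], [D_a] consists of the edges that meet [{i, l}], as [2 (m-1) >= m].
    Without a common neighbour, [i] and its neighbours would be closed under these edges and miss
    [l]. *)
Lemma common_neighbour i l : (1 < m)%N -> vertex i -> vertex l ->
  i != l -> ~~ adj i l -> exists2 j, adj i j & adj j l.
Proof.
move=> m1 [G1 G1E iG1] [G2 G2E lG2] il nadj.
have [/existsP[j /andP[]]|/existsPn noj] := boolP [exists j, adj i j && adj j l].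
  by exists j.
have degE G : degon (~: G) ((U_(i) + U_(l)) *+ m.-1)%MM =
    (((i \notin G) + (l \notin G)) * m.-1)%N.
  by rewrite degonMn degonD !degon1 !finset.in_setC.
suff : l \in [set v | (v == i) || adj i v].
  by rewrite inE eq_sym (negPf il) (negPf nadj).
apply: (degree_complex_connected (a := ((U_(i) + U_(l)) *+ m.-1)%MM) (v1 := i)
  _ G1E _ iG1 _ G2E) => //.
- move=> G v w GE; rewrite degE => Ga vG wG; rewrite !inE.
  case: (eqVneq w i) => //= wi; case: (boolP (i \in G)) Ga => iG.
    by move=> _ _; apply: (edge_adj GE) => //; rewrite eq_sym.
  case: (boolP (l \in G)) => [lG _|_ /= Ga]; last first.
    by exfalso; move: Ga m1; clear; lia.
  case: (eqVneq v i) => [vi _|_ /= iv]; first by rewrite -vi vG in iG.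
  have := noj v; rewrite iv /=; case: (eqVneq v l) => [vl|vl].
    by rewrite -vl iv in nadj.
  by rewrite (edge_adj GE vG lG vl).
- by rewrite degE iG1; case: (l \notin G1); move: m1; clear; lia.
- by rewrite inE eqxx.
- by rewrite degE lG2; case: (i \notin G2); move: m1; clear; lia.
Qed.

(** For [x^a = x_i^(m-1) x_j x_l], the edge [{j, l}] and the edges at [i] lie in [D_a], the latter
    because [2 < m], whereas an edge missing [i] and meeting [{j, l}] in one vertex has degree [m]
    off it. So connectedness needs an edge from [i] to [j] or [l]. *)
Lemma edge_dominates i j l : (2 < m)%N -> vertex i -> adj j l ->
  i != j -> i != l -> adj i j || adj i l.
Proof.
move=> m2 [G1 G1E iG1] jl ij il; apply/negPn/negP => /norP[nij nil].
pose a : 'X_{1..n} := (U_(i) *+ m.-1 + (U_(j) + U_(l)))%MM.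
have degE G : degon (~: G) a =
    ((i \notin G) * m.-1 + ((j \notin G) + (l \notin G)))%N.
  by rewrite !degonD degonMn !degon1 !finset.in_setC.
have jG : j \in [set j; l] by rewrite !inE eqxx.
have lG : l \in [set j; l] by rewrite !inE eqxx orbT.
suff : i \in [set j; l] by rewrite !inE (negPf ij) (negPf il).
apply: (degree_complex_connected (a := a) (v1 := j) _ jl _ _ _ G1E) => //.
- move=> G v w GE; rewrite degE => Ga vG wG vC; apply/negPn/negP => wC.
  have vw : v != w by apply: contraNneq wC => <-.
  move: wC Ga; rewrite !inE => /norP[wj wl].
  have iw : i == w = false.
    apply/eqP => iw; move: (edge_adj GE wG vG); rewrite eq_sym vw -iw => /(_ isT).
    by move: vC; rewrite !inE => /orP[]/eqP->; apply/negP.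
  rewrite (edgeE GE vG wG vw) !inE iw orbF ![_ == w]eq_sym (negPf wj) (negPf wl).
  move: vC; rewrite !inE => /orP[]/eqP->; rewrite (negPf ij, negPf il) /=.
    by rewrite eq_sym (negPf (adj_neq jl)); move: m2; clear; lia.
  by rewrite (negPf (adj_neq jl)); move: m2; clear; lia.
- by rewrite degE jG lG; case: (i \notin _); move: m2; clear; lia.
- by rewrite degE iG1; case: (j \notin _); case: (l \notin _); move: m2; clear; lia.
Qed.

End CohenMacaulay.

Lemma edge_chain J G : G \in E -> (J `<=` var_ideal (~: G))%classic ->
  quot_prime_chain J 2.
Proof.
move=> GE JG; have [v [w [GE' vw]]] := edge_ends GE.
pose F i : {set 'I_n} := if i is i'.+1 then if i' is 0 then [set v] else
  finset.set0 else G.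
have sF i : F i.+1 \subset F i.
  by case: i => [|[|i]] /=; rewrite ?finset.sub0set // GE' finset.sub1set !inE eqxx.
exists (fun i => var_ideal (~: F i)); split=> i i2.
  split; first exact: var_ideal_prime.
  apply: subset_trans JG _; apply/var_ideal_subset; rewrite finset.setCS.
  by case: i i2 => [|[|i]] _ /=; rewrite ?finset.sub0set // GE' finset.sub1set
    !inE eqxx.
split; first by apply/var_ideal_subset; rewrite finset.setCS.
move=> /var_ideal_subset; rewrite finset.setCS.
case: i i2 => [|[|i]] //= _ => [|/fintype.subsetP/(_ v)];
  last by rewrite !inE eqxx => /(_ isT).
by rewrite GE' => /subset_leq_card; rewrite cards1 cards2 (adj_neq vw).
Qed.

(** The prime chain of [edge_chain] forces dimension at least 2, and the depth equals the
    dimension. *)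
Lemma cohen_macaulay_regular_pair J G : is_ideal J -> G \in E ->
  (J `<=` var_ideal (~: G))%classic -> quot_cohen_macaulay J ->
  exists f g : S, [/\ var_ideal [set: 'I_n] f, var_ideal [set: 'I_n] g
    & regular_pair J f g].
Proof.
move=> iJ GE JG [d [[_ dmax] [[s reg sd] _]]].
by apply: (regular_seq_pair iJ reg); rewrite sd; apply: dmax; apply: (edge_chain GE).
Qed.

End EdgeIdeals.

(** * Symbolic and ordinary powers *)

Section FacetsOfGraph.
Context {n : nat}.
Variable Delta : {set {set 'I_n}}.

Lemma facet_face G : G \in facets Delta -> G \in Delta.
Proof. by rewrite inE => /maxsetp. Qed.

Lemma face_facet F : F \in Delta -> exists2 G, G \in facets Delta & F \subset G.
Proof.
move=> FD; have [G maxG FG] := maxset_exists (P := fun G => G \in Delta) FD.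
by exists G; rewrite // inE.
Qed.

Lemma facet_eq F G : G \in facets Delta -> F \in Delta -> G \subset F -> F = G.
Proof. by rewrite inE => /maxsetP[_]; apply. Qed.

Hypothesis Delta_pure : pure_complex Delta.
Hypothesis Delta_dim : complex_dim Delta = 1.

Lemma card_facet G : G \in facets Delta -> #|G| = 2%N.
Proof.
move=> GF; move: Delta_dim; rewrite /complex_dim.
rewrite (eq_bigr (fun=> #|G|)) => [|F FF]; last first.
  by have := Delta_pure FF GF; rewrite /face_dim; lia.
suff -> : (\max_(i in facets Delta) #|G|)%N = #|G| by lia.
apply/eqP; rewrite eqn_leq; apply/andP; split; first exact/bigmax_leqP.
by rewrite (bigD1 G) //= leq_maxl.
Qed.

Lemma facet_exists : exists G, G \in facets Delta.
Proof.
apply/set0Pn; apply/eqP => F0; move: Delta_dim.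
by rewrite /complex_dim F0 big_set0.
Qed.

End FacetsOfGraph.

(** * Comparison of ordinary and symbolic powers of the Stanley-Reisner ideal *)

Section StanleyReisner.
Local Open Scope set_scope.
Context {k : fieldType} {n : nat}.
Local Notation S := {mpoly k[n]}.
Variable Delta : {set {set 'I_n}}.
Hypothesis Delta_complex : simplicial_complex Delta.
Local Notation E := (facets Delta).
Hypothesis card_edge : forall G, G \in E -> #|G| = 2%N.
Implicit Types (a b : 'X_{1..n}) (F G : {set 'I_n}).

Lemma symbolic_powerE m : symbolic_power k Delta m = mideal (symb E m).
Proof.
apply/seteqP; split=> [f Sf a af G GE|f Ef G GE].
  by have := Sf G GE; rewrite var_ideal_pow => /(_ a af).
by rewrite var_ideal_pow => a /Ef; apply.
Qed.

Definition msupport a : {set 'I_n} := [set i | (0 < a i)%N].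

Definition nonface : set 'X_{1..n} := [set a | msupport a \notin Delta]%classic.

Lemma msupport_add a b : msupport a \subset msupport (a + b)%MM.
Proof. by apply/fintype.subsetP => i; rewrite !inE mnmDE; lia. Qed.

Lemma nonface_up : upward nonface.
Proof. by move=> a b; apply: contra => /Delta_complex; apply;
  apply: msupport_add. Qed.

Lemma stanley_reisnerE : stanley_reisner k Delta = mideal nonface.
Proof.
pose x F : 'X_{1..n} := (\sum_(i in F) U_(i))%MM.
have xE F i : x F i = (i \in F).
  by rewrite -degon1 /degon mnm_sumE; apply: eq_bigr => j _; rewrite !mnm1E eq_sym.
rewrite -(@gen_mideal _ _ _ (x @` [set F | F \notin Delta])%classic).
- rewrite /stanley_reisner image_comp; congr (ideal_gen (_ @` _)%classic).
  by apply/funext => F /=; rewrite /x -mprodXE.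
- exact: nonface_up.
- move=> _ [F /= FD <-]; rewrite /nonface /= (_ : msupport _ = F) //.
  by apply/setP => i; rewrite inE xE; case: (i \in F).
- move=> a aD; exists (x (msupport a)); first by exists (msupport a).
  by apply/mnm_lepP => i; rewrite xE inE; case: (a i).
Qed.

Definition ordpow m := mset_pow nonface m.

Lemma ordinary_powerE m :
  ideal_pow (stanley_reisner k Delta) m = mideal (ordpow m).
Proof. by rewrite stanley_reisnerE ideal_pow_mideal. Qed.

Lemma ordpow_up m : upward (ordpow m).
Proof. exact: mset_pow_upward. Qed.

Lemma nonface_degon a G : nonface a -> G \in E -> (1 <= degon (~: G) a)%N.
Proof.
move=> aD GE; rewrite lt0n; apply: contraNneq aD => a0.
apply: (Delta_complex (facet_face GE)); apply/fintype.subsetP => i.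
rewrite inE; apply: contraTT => iG; rewrite -leqNgt -a0.
by apply: leq_degon; rewrite finset.in_setC.
Qed.

Lemma ordpow_symb m a : ordpow m a -> symb E m a.
Proof.
rewrite /ordpow => Wa G GE; apply/(mset_pow_degon (~: G)).
elim: m a Wa => [//|m IHm] _ [b [c [bD cW ->]]].
by exists b, c; split=> //; [apply: nonface_degon|apply: IHm].
Qed.

Lemma ordpowMn m a : nonface a -> ordpow m (a *+ m)%MM.
Proof.
move=> aD; elim: m => [//|m IHm]; rewrite mulmS.
by exists a, (a *+ m)%MM.
Qed.

Lemma msupport_nonface a G i : G \in E -> (G \subset msupport a) ->
  i \notin G -> (0 < a i)%N -> nonface a.
Proof.
move=> GE Ga iG ai; apply/negP => aD.
by move: iG; rewrite -(facet_eq GE aD Ga) inE ai.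
Qed.

(** Inverting [x_v x_w] turns [I] into [P_(~: {v, w})]: for [l] off the facet [{v, w}],
    [x_l x_v x_w] is in [I] by maximality. Each of [m] such factors [x_l] of [x^a] takes one copy of
    [x_v x_w]. *)
Lemma ordpow_edge m a v w : adj E v w -> (m <= degon (~: [set v; w]) a)%N ->
  ordpow m (a + (U_(v) + U_(w)) *+ m)%MM.
Proof.
move=> vw; elim: m a => [//|m IHm] a ma.
have [l lG al] := degon_gt0 (leq_ltn_trans (leq0n _) ma).
have Ua : (U_(l) <= a)%MM.
  by apply/mnm_lepP => j; rewrite mnm1E; case: eqP => // <-.
exists (U_(l) + (U_(v) + U_(w)))%MM, (a - U_(l) + (U_(v) + U_(w)) *+ m)%MM; split.
- rewrite finset.in_setC in lG.
  apply: (msupport_nonface vw _ lG); last by rewrite !mnmDE !mnm1E eqxx.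
  apply/fintype.subsetP => i; rewrite !inE !mnmDE !mnm1E.
  by case/orP=> /eqP->; rewrite eqxx; lia.
- apply: IHm; move: ma; rewrite -{1}(submK Ua) degonD degon1 lG.
  by lia.
- by apply/mnmP => i; have /mnm_lepP/(_ i) := Ua;
    rewrite !(mnmDE, mnmBE, mulmnE, mnm1E); lia.
Qed.

(** If [{v, w}] is not an edge, it is not a face, and [(x_v x_w)^m] alone is in [I^m]. *)
Lemma ordpow_pair m a v w : symb E m a -> v != w ->
  ordpow m (a + U_(v) *+ m + U_(w) *+ m)%MM.
Proof.
move=> Ea vw.
have -> : (a + U_(v) *+ m + U_(w) *+ m = a + (U_(v) + U_(w)) *+ m)%MM.
  by apply/mnmP => i; rewrite !(mnmDE, mulmnE); lia.
have [adjvw|nadj] := boolP (adj E v w); first by apply: ordpow_edge => //; apply: Ea.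
rewrite addmC; apply/ordpow_up/ordpowMn; apply/negP => /face_facet[G GE sG].
have inG u : (u == v) || (u == w) -> u \in G.
  move=> uvw; apply: (fintype.subsetP sG); rewrite inE mnmDE !mnm1E ![_ == u]eq_sym.
  by case/orP: uvw => ->; lia.
move: nadj; rewrite (edge_adj card_edge GE _ _ vw) //; apply: inG.
  by rewrite eqxx.
by rewrite eqxx orbT.
Qed.

Lemma regular_pair_ordinary_eq_symbolic m (f g : S) :
  (exists G, G \in E) ->
  var_ideal [set: 'I_n] f -> var_ideal [set: 'I_n] g ->
  regular_pair (mideal (ordpow m)) f g -> ordpow m = symb E m.
Proof.
move=> [G0 G0E] mf mg regI; apply/seteqP; split=> a; first exact: ordpow_symb.
move=> Ea; apply: contrapT => nWa.
(* A monomial outside [I^m] that large powers of all variables but [x_v] carry into [I^m]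
   contradicts depth 2. *)
suff [b [v [nWb Wb]]] : exists b v, ~ ordpow m b /\
    forall w, w != v -> ordpow m (b + U_(w) *+ m)%MM.
  apply: (regular_pair_no_socle mf mg (@ordpow_up m) regI (v := v)
    (N := (b v + m).+1) nWb); first by rewrite ltnS leq_addr.
  move=> w /Wb Wbw; rewrite (_ : (b + _)%MM = (b + U_(w) *+ m + U_(w) *+ (b
    v).+1)%MM).
    exact: ordpow_up.
  by apply/mnmP => i; rewrite !(mnmDE, mulmnE); lia.
(* If some [x_v^m] keeps [x^a] outside [I^m], then [ordpow_pair] lets every other variable carry the
   product into [I^m]; if none does, [x^a] itself serves, with any [v]. *)
have [[v nWv]|allW] := pselect (exists v, ~ ordpow m (a + U_(v) *+ m)%MM).
  exists (a + U_(v) *+ m)%MM, v; split=> // w wv.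
  by apply: ordpow_pair; rewrite // eq_sym.
have [v _] := edge_ends card_edge G0E; exists a, v; split=> // w _.
by apply: contrapT => nW; apply: allW; exists w.
Qed.

(** The variables outside [Q] form a face, since [Q] contains the [m]-th power of every nonface
    product; any facet containing this face will do. *)
Lemma prime_contains_facet (Q : set S) m : prime_ideal Q ->
  (ideal_pow (stanley_reisner k Delta) m `<=` Q)%classic ->
  exists2 G, G \in E & (var_ideal (~: G) `<=` Q)%classic.
Proof.
move=> primeQ IQ; pose F := [set v : 'I_n | `[< ~ Q 'X_v >]].
have FD : F \in Delta.
  apply: contrapT => /negP FD.
  have /(prime_idealX primeQ)/(prime_ideal_prod primeQ)[v] :
      Q ((\prod_(v in F) 'X_v) ^+ m).
    by apply: IQ; apply: ideal_powX; apply: sub_ideal_gen; exists F.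
  by rewrite inE => /asboolP.
have [G GE FG] := face_facet FD; exists G => //.
apply: ideal_gen_min; first by case: primeQ.
move=> _ [v /= vG <-]; apply: contrapT => nQv.
by move: vG; rewrite finset.in_setC (fintype.subsetP FG) // inE; apply/asboolP.
Qed.

Lemma power_sub_facet m G : (0 < m)%N -> G \in E ->
  (mideal (symb E m) `<=` (var_ideal (~: G) : set S))%classic.
Proof.
move=> m0 GE f Ef; rewrite var_idealE => a /Ef/(_ G GE).
exact: leq_trans.
Qed.

Lemma ordinary_sub_symbolic m :
  (mideal (ordpow m) `<=` (mideal (symb E m) : set S))%classic.
Proof. by move=> f Wf a /Wf/ordpow_symb. Qed.

(** Stated for any ideal between [I^m] and [I^(m)], to serve both powers. The [P_(~: G)] are
    pairwise incomparable because all edges have two elements. *)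
Lemma min_primesE m (J : set S) : (0 < m)%N ->
  (mideal (ordpow m) `<=` J)%classic -> (J `<=` mideal (symb E m))%classic ->
  min_primes J = [set var_ideal (~: G) | G in [set` E]]%classic.
Proof.
move=> m0 IJ Jsymb.
have PJ G : G \in E -> (J `<=` var_ideal (~: G))%classic.
  by move=> GE; apply: subset_trans Jsymb _; apply: power_sub_facet.
have JP Q : prime_ideal Q -> (J `<=` Q)%classic ->
    exists2 G, G \in E & (var_ideal (~: G) `<=` Q)%classic.
  move=> primeQ JQ; apply: (@prime_contains_facet Q m) => //.
  by rewrite ordinary_powerE; apply: subset_trans IJ _.
apply/seteqP; split=> [Q [primeQ JQ minQ]|_ [G /= GE <-]].
  have [G GE GQ] := JP Q primeQ JQ; exists G => //.
  by apply: minQ => //; [apply: var_ideal_prime|apply: PJ].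
split; [exact: var_ideal_prime|exact: PJ|] => Q primeQ JQ QG.
have [G' G'E G'Q] := JP Q primeQ JQ.
have /var_ideal_subset := subset_trans G'Q QG; rewrite finset.setCS => GG'.
have eqG : G = G' by apply/eqP; rewrite eqEcard GG' !card_edge.
by apply/seteqP; split => //; rewrite eqG.
Qed.

Lemma clean_ordinary_eq_symbolic m : (0 < m)%N ->
  quot_clean (ideal_pow (stanley_reisner k Delta) m) -> ordpow m = symb E m.
Proof.
rewrite ordinary_powerE => m0 [r [C [p [[C0 Cr _ Cp] suppp]]]].
apply/seteqP; split=> a; first exact: ordpow_symb.
move=> Ea; apply: contrapT => nWa.
(* [i] is the step where [x^a] enters the filtration. The factor there is some [S / P_(~: G)], on
   which the monomial [s] below, in the variables of [G], is a nonzerodivisor; yet [s x^a] already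
   lies in [I^m]. *)
have [i ir [CXi nCXi]] : exists2 i, (i < r)%N & C i.+1 'X_[a] /\ ~ C i 'X_[a].
  apply: contrapT => noi; apply/nWa/(midealX (k := k)); rewrite -C0.
  suff CX j : (j <= r)%N -> C (r - j)%N 'X_[a] by rewrite -(subnn r); apply: CX.
  elim: j => [|j IHj] jr; first by rewrite subn0 Cr.
  apply: contrapT => nCX; apply: noi; exists (r - j.+1)%N; first by lia.
  by split=> //; rewrite -subSn // subSS; apply: IHj; apply: ltnW.
have [_ _ primep [phi [_ _ phiM phiN _]]] := Cp i ir.
have C0i : (C 0%N `<=` C i)%classic.
  elim: i ir {CXi nCXi primep phi phiM phiN} => [_ f|i IHi ir] //.
  apply: subset_trans (IHi (ltnW ir)) _.
  by have [] := Cp i (ltnW ir).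
have : min_primes (mideal (ordpow m) : set S) (p i) by rewrite -suppp; exists i.
rewrite (min_primesE m0) //; last exact: ordinary_sub_symbolic.
case=> G /= GE pE; have [v [w [GE' vw]]] := edge_ends card_edge GE.
pose s : S := 'X_[(U_(v) + U_(w)) *+ m].
have CsX : C i (s * 'X_[a]).
  apply: C0i; rewrite C0 /s -mpolyXD addmC; apply/midealX/ordpow_edge => //.
  by rewrite -GE'; apply: Ea.
have CsX' : C i.+1 (s * 'X_[a]) by have [+ _ _ _] := Cp i ir; apply.
have [ip _ pM] := primep.
have /pM[] := ideal_subKr ip (phiM s _ CXi) ((phiN _ CsX').1 CsX).
  rewrite -pE => /var_idealX; rewrite degonMn degonD !degon1 !finset.in_setC GE'.
  by rewrite !inE !eqxx orbT.
by move=> /(phiN _ CXi).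
Qed.

End StanleyReisner.

(** * Filtrations from shellings *)

Section Shelling.
Local Open Scope set_scope.
Context {k : fieldType} {n : nat}.
Local Notation S := {mpoly k[n]}.
Implicit Types (a b c : 'X_{1..n}) (F G : {set 'I_n}).

Definition off G a : 'X_{1..n} := [multinom (if i \in G then 0%N else a i) | i < n].

Lemma offE G a i : off G a i = if i \in G then 0%N else a i.
Proof. exact: mnmE. Qed.

Lemma mdeg_off G a : mdeg (off G a) = degon (~: G) a.
Proof.
rewrite mdegE /degon [RHS]big_mkcond; apply: eq_bigr => i _.
by rewrite offE finset.in_setC; case: (i \in G).
Qed.

Lemma off_id G a : off G (off G a) = off G a.
Proof. by apply/mnmP => i; rewrite !offE; case: (i \in G). Qed.

Lemma offD G a b : off G (a + b)%MM = (off G a + off G b)%MM.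
Proof. by apply/mnmP => i; rewrite !(offE, mnmDE); case: (i \in G). Qed.

Variables (E : {set {set 'I_n}}) (m : nat).
Hypothesis card_edge : forall G, G \in E -> #|G| = 2%N.
(** [rk] orders the components [(G, b)]. The second hypothesis on it is a shelling condition in
    every [D_a]: an edge disjoint from one that is not later meets a strictly earlier edge. *)
Variable rk : {set 'I_n} -> 'X_{1..n} -> nat.
Hypothesis rk_mdeg : forall G G' b b', (mdeg b < mdeg b')%N -> (rk G b < rk G' b')%N.
Hypothesis rk_shelling : forall G G' a, G \in E -> G' \in E -> [disjoint G & G'] ->
  (mdeg (off G a) < m)%N -> (rk G' (off G' a) <= rk G (off G a))%N ->
  exists G'' v, [/\ G'' \in E, v \in G'', v \in G &
    (rk G'' (off G'' a) < rk G (off G a))%N].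

Local Notation item := ({set 'I_n} * 'X_{1..n})%type.

Definition item_rk (x : item) := rk x.1 x.2.

(** The item [(G, b)] stands for the monomials [x^a] with [off G a = b], that is, for [x^b
    k[x_i, x_j]] when [G = {i, j}]. Ties in rank are broken by the sort. *)
Definition items : seq item :=
  sort (relpre item_rk leq)
    (undup [seq (G, off G (val d)) | G <- enum E, d <- enum {: 'X_{1..n < m}}]).

Lemma mem_items G b :
  (G, b) \in items = [&& G \in E, (mdeg b < m)%N & off G b == b].
Proof.
rewrite mem_sort mem_undup; apply/allpairsP/and3P => [[[G' b'] /=]|[GE bm /eqP Gb]].
  rewrite !mem_enum => -[G'E _ [-> ->]]; split=> //; last by rewrite off_id.
  apply: leq_ltn_trans (bmdeg b'); rewrite mdeg_off mdegE.
  by rewrite /degon big_mkcond leq_sum // => i _; case: ifP.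
by exists (G, BMultinom bm); split; rewrite /= ?mem_enum ?Gb.
Qed.

Lemma items_uniq : uniq items.
Proof. by rewrite sort_uniq undup_uniq. Qed.

Lemma items_sorted : sorted (relpre item_rk leq) items.
Proof. by apply: sort_sorted => x y; apply: leq_total. Qed.

Let x0 : item := (finset.set0, 0%MM).

Lemma index_rk x y : x \in items -> y \in items ->
  (index x items <= index y items)%N -> (item_rk x <= item_rk y)%N.
Proof.
move=> xL yL xy; rewrite -(nth_index x0 yL) -(nth_index x0 xL).
have tr : transitive (relpre item_rk leq) by move=> u v w; apply: leq_trans.
have rf : reflexive (relpre item_rk leq) by move=> u; apply: leqnn.
by apply: (sorted_leq_nth tr rf x0 items_sorted); rewrite ?inE ?index_mem.
Qed.

Lemma index_rk_lt x y : x \in items -> y \in items ->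
  (item_rk x < item_rk y)%N -> (index x items < index y items)%N.
Proof.
by move=> xL yL; apply: contraTT; rewrite -!leqNgt; apply: index_rk.
Qed.

(** The exponents outside the first [s] components: [s = 0] gives [S], [s = size items] gives [J],
    and the ideals in between form the filtration. *)
Definition uncovered s : set 'X_{1..n} :=
  [set a | forall G, G \in E -> (G, off G a) \notin take s items]%classic.

Lemma coveredP s a : ~ uncovered s a ->
  exists2 G, G \in E & (G, off G a) \in take s items.
Proof.
move=> Va; apply: contrapT => noG; apply: Va => G GE.
by apply/negP => Ga; apply: noG; exists G.
Qed.

(** Passing from [x^(a+b)] to its divisor [x^a] either keeps the part off [G] or lowers its degree,
    hence its rank; so a component covering [a + b] yields one, at most as late, covering [a]. *)
Lemma uncovered_up s : upward (uncovered s).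
Proof.
move=> a b Va G GE; apply: contra (Va G GE) => sab.
have [b0|b0] := eqVneq (off G b) 0%MM; first by move: sab; rewrite offD b0 addm0.
have lt_ab : (mdeg (off G a) < mdeg (off G (a + b)))%N.
  rewrite offD mdegD; move: b0; rewrite -mdeg_eq0; clear; lia.
have abL := mem_take sab; have := abL; rewrite mem_items => /and3P[_ abm _].
have aL : (G, off G a) \in items.
  by rewrite mem_items GE off_id eqxx (ltn_trans lt_ab).
rewrite in_take //; apply: leq_trans (index_ltn sab).
by rewrite ltnS ltnW //; apply: index_rk_lt => //; apply: rk_mdeg.
Qed.

Lemma uncovered_all a : uncovered (size items) a <-> symb E m a.
Proof.
rewrite /uncovered /symb /= take_size; split=> Va G GE; have := Va G GE.
  by rewrite mem_items GE mdeg_off off_id eqxx andbT /= -leqNgt.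
by rewrite mem_items mdeg_off leqNgt => /negPf->; rewrite andbF.
Qed.

Lemma uncovered0 a : uncovered 0 a.
Proof. by move=> G GE; rewrite take0. Qed.

Section Step.
Variables (s : nat) (G : {set 'I_n}) (b : 'X_{1..n}).
Hypothesis sL : (s < size items)%N.
Hypothesis nthL : nth x0 items s = (G, b).

Lemma item_mem : (G, b) \in items.
Proof. by rewrite -nthL mem_nth. Qed.

Lemma item_edge : G \in E.
Proof. by have := item_mem; rewrite mem_items => /and3P[]. Qed.

Lemma item_deg : (mdeg b < m)%N.
Proof. by have := item_mem; rewrite mem_items => /and3P[]. Qed.

Lemma item_off : off G b = b.
Proof. by have := item_mem; rewrite mem_items => /and3P[_ _ /eqP]. Qed.

Lemma index_item : index (G, b) items = s.
Proof. by rewrite -nthL index_uniq ?items_uniq. Qed.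

Lemma uncoveredS a : uncovered s.+1 a <-> uncovered s a /\ off G a <> b.
Proof.
have takeS x : x \in take s.+1 items = (x \in take s items) || (x == (G, b)).
  by rewrite (take_nth x0) // mem_rcons inE nthL orbC.
split=> [Va|[Va Gab] G' G'E].
  split=> [G' G'E|Gab]; first by have := Va G' G'E; rewrite takeS negb_or => /andP[].
  by have := Va G item_edge; rewrite takeS Gab eqxx orbT.
rewrite takeS negb_or Va //=; apply/eqP => -[G'G Gab']; apply: Gab.
by rewrite -G'G.
Qed.

(** The shelling condition replaces a covering edge disjoint from [G] by one that meets [G]. *)
Lemma item_uncovered a : off G a = b -> ~ uncovered s a ->
  exists G' v, [/\ G' \in E, v \in G, v \in G' & (G', off G' a) \in take s items].
Proof.
move=> Gab /coveredP[G1 G1E G1a].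
have [dGG1|/pred0Pn[v /andP[/= vG vG1]]] := boolP [disjoint G & G1]; last first.
  by exists G1, v.
have Gam : (mdeg (off G a) < m)%N by rewrite Gab item_deg.
have leR : (rk G1 (off G1 a) <= rk G (off G a))%N.
  rewrite Gab; apply: (@index_rk (G1, off G1 a) (G, b)).
  - exact: mem_take G1a.
  - exact: item_mem.
  - by rewrite index_item ltnW // index_ltn.
have [G2 [v [G2E vG2 vG ltR]]] := rk_shelling item_edge G1E dGG1 Gam leR.
exists G2, v; split=> //.
(* A rank below that of [(G, off G a)] bounds the degree of [off G2 a] by that of [off G a], so this
   item is listed. *)
have G2L : (G2, off G2 a) \in items.
  rewrite mem_items G2E off_id eqxx andbT /=; apply: leq_ltn_trans Gam.
  by rewrite leqNgt; apply/negP => /(rk_mdeg G G2)/(ltn_trans ltR); rewrite ltnn.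
rewrite in_take // -index_item; apply: index_rk_lt => //; first exact: item_mem.
by rewrite /item_rk /= -Gab.
Qed.

(** In the quadrant [x^b x_i^x x_j^y] the points covered earlier form a union of strips [x < p] and
    [y < q], because an edge through [i] or [j] covers whole lines in that direction. What remains
    is a translated quadrant with corner [u]. *)
Lemma item_generator : exists u,
  [/\ uncovered s u, off G u = b
    & forall a, uncovered s a -> off G a = b -> (u <= a)%MM].
Proof.
have [i [j [GE ij]]] := edge_ends card_edge item_edge.
have ij' := adj_neq card_edge ij.
have iG : i \in G by rewrite GE !inE eqxx.
have jG : j \in G by rewrite GE !inE eqxx orbT.
pose pt x y : 'X_{1..n} := (b + U_(i) *+ x + U_(j) *+ y)%MM.
have ptG x y : off G (pt x y) = b.
  rewrite !offD item_off; apply/mnmP => l; rewrite !(mnmDE, offE, mulmnE, mnm1E).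
  by rewrite GE !inE ![l == _]eq_sym; case: eqP => [_|_]; case: eqP => _ //=;
    rewrite !addn0.
have pti G' x x' y : i \in G' -> off G' (pt x y) = off G' (pt x' y).
  move=> iG'; apply/mnmP => l; rewrite !offE !mnmDE !mulmnE !mnm1E.
  by case: (boolP (l \in G')) => // lG'; case: eqP => // il; rewrite -il iG' in lG'.
have ptj G' x y y' : j \in G' -> off G' (pt x y) = off G' (pt x y').
  move=> jG'; apply/mnmP => l; rewrite !offE !mnmDE !mulmnE !mnm1E.
  by case: (boolP (l \in G')) => // lG'; case: (eqVneq j l) => // jl;
    rewrite -jl jG' in lG'.
have ptup x y x' y' : (x <= x')%N -> (y <= y')%N -> uncovered s (pt x y) ->
  uncovered s (pt x' y').
  move=> xx yy V; rewrite (_ : pt x' y' = (pt x y + (U_(i) *+ (x' - x) + U_(j)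
    *+ (y' - y)))%MM).
    exact: uncovered_up.
  by apply/mnmP => l; rewrite !(mnmDE, mulmnE);
    rewrite -{1}(subnKC xx) -{1}(subnKC yy); clear; lia.
have Vmm : uncovered s (pt m m).
  move=> G' G'E; apply/negP => G'a; have := mem_take G'a.
  rewrite mem_items => /and3P[_ G'm _].
  have inG' v : (v == i) || (v == j) -> v \in G'.
    move=> vij; apply: contraTT G'm => vG'; rewrite -leqNgt mdeg_off.
    apply: (@leq_trans (pt m m v)); last by apply: leq_degon; rewrite finset.in_setC.
    rewrite !(mnmDE, mulmnE, mnm1E) ![_ == v]eq_sym.
    by case/orP: vij => ->; clear; lia.
  have eqG : G' = G.
    by rewrite GE; apply: (edgeE card_edge) => //; apply: inG'; rewrite eqxx ?orbT.
  by have := index_ltn G'a; rewrite eqG ptG index_item ltnn.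
(* [p] is the least abscissa of an uncovered point and [q] the least ordinate. An edge through [i]
   covering [pt p q] would cover [pt x1 q], and one through [j] would cover [pt p y0]. *)
pose P x := `[< exists y, uncovered s (pt x y) >].
pose Q y := `[< exists x, uncovered s (pt x y) >].
have exP : exists x, P x by exists m; apply/asboolP; exists m.
have exQ : exists y, Q y by exists m; apply/asboolP; exists m.
have [p /asboolP[y0 Py0] minP] := ex_minnP exP.
have [q /asboolP[x1 Qx1] minQ] := ex_minnP exQ.
exists (pt p q); split=> //.
  apply: contrapT => /(item_uncovered (ptG p q))[G' [v [G'E vG vG' G'a]]].
  have : v \in [set i; j] by rewrite -GE.
  rewrite !inE => /orP[]/eqP vE; rewrite {}vE in vG'.
    by have := Qx1 G' G'E; rewrite (pti _ x1 p) // G'a.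
  by have := Py0 G' G'E; rewrite (ptj _ p y0 q) // G'a.
move=> a Va Gab.
have aE : a = pt (a i) (a j).
  apply/mnmP => l; rewrite !(mnmDE, mulmnE, mnm1E).
  have := congr1 (fun c : 'X_{1..n} => c l) Gab;
    rewrite offE GE !inE ![l == _]eq_sym.
  case: (eqVneq i l) => [<- <-|il];
    first by rewrite ?eqxx ![j == i]eq_sym (negPf ij') /=; clear; lia.
  by case: (eqVneq j l) => [<- <-|jl <-] /=; rewrite ?eqxx ?mul0n ?mul1n ?addn0.
rewrite aE in Va *; apply/mnm_lepP => l.
have pa : (p <= a i)%N by apply: minP; apply/asboolP; exists (a j).
have qa : (q <= a j)%N by apply: minQ; apply/asboolP; exists (a i).
by rewrite !(mnmDE, mulmnE) !leq_add // leq_mul.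
Qed.

(** The smaller ideal and [x^u] generate the larger one. A monomial multiple of [x^u] leaves the
    component [(G, b)] exactly when the multiplier involves a variable off [G], so the colon ideal
    is [P_(~: G)]. *)
Lemma filtration_step :
  subquot_iso (mideal (uncovered s) :
    set S) (mideal (uncovered s.+1)) setT (var_ideal (~: G)).
Proof.
have [u [Vu uG umin]] := item_generator.
have iV t := mideal_ideal (k := k) (@uncovered_up t).
apply: (@sub_quot_iso_adjoin _ _ _ _ 'X_[u]) => // f; split.
- move: f; apply: mideal_sub; first exact: ideal_adjoin_ideal.
  move=> a Va; have [aVS|aVS] := pselect (uncovered s.+1 a).
    by exists 0; rewrite mul0r subr0; apply/midealX.
  have Gab : off G a = b by apply: contrapT => nab; apply/aVS/uncoveredS.
  exists 'X_[a - u]; rewrite -mpolyXD submK ?subrr; last exact: umin.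
  exact: ideal0.
- move=> [t Vt]; rewrite -(subrK (t * 'X_[u]) f); apply: (idealD (iV s)).
    by move=> a /Vt/uncoveredS[].
  by apply: (idealMl (iV s)); apply/midealX.
- rewrite var_idealE => Vf a af /=.
  have /uncoveredS[_ Gau] : uncovered s.+1 (a + u)%MM.
    by apply: Vf; rewrite addmC mcoeff_msupp mcoeffMX -mcoeff_msupp.
  rewrite lt0n; apply: contra_notN Gau; rewrite -mdeg_off mdeg_eq0 => /eqP Ga.
  by rewrite offD Ga add0m.
- rewrite var_idealE; move: f; apply: mideal_sub.
    split=> [|f g Vf Vg|r f Vf]; first by rewrite /= mul0r; apply: (ideal0 (iV _)).
      by rewrite /= mulrDl; apply: (idealD (iV _)).
    by rewrite /= -mulrA; apply: (idealMl (iV _)).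
  move=> a /= Ga; rewrite -mpolyXD; apply/midealX/uncoveredS; split.
    by rewrite addmC; apply: uncovered_up.
  rewrite offD uG -{2}[b]add0m => /addIm/eqP; rewrite -mdeg_eq0 mdeg_off.
  by rewrite -leqn0 leqNgt Ga.
Qed.

End Step.

Lemma shelling_filtration : (0 < m)%N -> exists r (C p : nat -> set S),
  prime_filtration (mideal (symb E m)) r C p /\
  [set p i | i in [set i | (i < r)%N]]%classic =
    [set var_ideal (~: G) | G in [set` E]]%classic.
Proof.
move=> m0; pose r := size items.
(* Reversed, because the filtration ascends from [J] while [uncovered s] shrinks as [s] grows. *)
pose C i : set S := mideal (uncovered (r - i)).
pose p i : set S := var_ideal (~: (nth x0 items (r - i.+1)).1).
exists r, C, p; split; last first.
  apply/seteqP; split=> [_ [i /= ir <-]|_ [G /= GE <-]].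
    exists (nth x0 items (r - i.+1)).1 => //=.
    case Gb: (nth _ _ _) => [G b]; apply: (item_edge _ Gb).
    by rewrite -/r; move: ir; clear; lia.
  (* Every [P_(~: G)] occurs, through the component with trivial monomial, which is listed because
     [0 < m]. *)
  have GL : (G, 0%MM) \in items.
    rewrite mem_items GE mdeg0 m0; apply/eqP/mnmP => i.
    by rewrite offE mnm0E; case: ifP.
  have iL : (index (G, 0%MM : 'X_{1..n}) items < r)%N by rewrite index_mem.
  exists (r - (index (G, 0%MM : 'X_{1..n}) items).+1)%N => /=.
    by move: iL; clear; lia.
  rewrite /p -subSn // subSS subKn ?nth_index //; exact: ltnW.
split.
- rewrite /C subn0; apply/seteqP; split=> f Uf a /Uf /uncovered_all //.
- by rewrite /C subnn; apply/seteqP; split=> f _ // a _; apply: uncovered0.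
- by move=> i _; apply/mideal_monomial/uncovered_up.
- move=> i ir; case Gb: (nth x0 items (r - i.+1)) => [G b].
  have sL : (r - i.+1 < size items)%N by rewrite -/r; move: ir; clear; lia.
  have rE : (r - i = (r - i.+1).+1)%N by move: ir; clear; lia.
  split.
  + by move=> f; rewrite /C rE => Vf a /Vf/(uncoveredS sL Gb)[].
  + exact: var_ideal_monomial.
  + exact: var_ideal_prime.
  + by rewrite /C rE /p Gb; apply: (filtration_step sL Gb).
Qed.

End Shelling.

(** * The shelling order *)

Section ShellingRank.
Local Open Scope set_scope.
Local Open Scope nat_scope.
Context {n : nat}.
Implicit Types (a b : 'X_{1..n}) (A F G : {set 'I_n}) (i j l v w : 'I_n).

(** The value on the empty set is [n], above every index, so that having no element ranks last. *)
Definition minidx A : nat :=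
  if [pick j in A | [forall i in A, j <= i]] is Some j then val j else n.

Variant minidx_spec A : nat -> Prop :=
  | MinIdx j of j \in A & (forall i, i \in A -> j <= i) : minidx_spec A j
  | MinIdx0 of A = finset.set0 : minidx_spec A n.

Lemma minidxP A : minidx_spec A (minidx A).
Proof.
rewrite /minidx; case: pickP => [j /andP[jA /forall_inP jmin]|noj].
  exact: MinIdx.
apply: MinIdx0; apply/eqP/set0Pn => -[i iA].
have [j jA jmin] := arg_minnP (fun j : 'I_n => val j) iA.
by have /negP[] := noj j; apply/andP; split=> //; apply/forall_inP.
Qed.

Lemma minidx_le A i : i \in A -> minidx A <= i.
Proof. by case: minidxP => [j _ /(_ i)|-> /[!inE]]. Qed.

Lemma minidx_leqn A : minidx A <= n.
Proof. by case: minidxP => [j _ _|//]; apply: ltnW. Qed.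

Variables (E : {set {set 'I_n}}) (m : nat).
Hypothesis card_edge : forall G, G \in E -> #|G| = 2.
Variable v0 : 'I_n.
Hypothesis v0_vertex : vertex E v0.
Hypothesis diam : forall i l, vertex E i -> vertex E l -> i != l ->
  ~~ adj E i l -> exists2 j, adj E i j & adj E j l.
Hypothesis dominates : 2 < m -> forall i j l, vertex E i -> adj E j l ->
  i != j -> i != l -> adj E i j || adj E i l.

(** The distance from [v0] to the edge [G], which [diam] bounds by 2. *)
Definition rank0 G := if v0 \in G then 0 else
  if [exists v in G, adj E v0 v] then 1 else 2.

(** The first edge on a shortest path from [G] to [v0] is closer to [v0]. Distance 0 is excluded, as
    disjoint edges do not both contain [v0]. *)
Lemma rank0_touch G G' : G \in E -> [disjoint G & G'] -> rank0 G' <= rank0 G ->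
  exists G'' v, [/\ G'' \in E, v \in G'', v \in G & rank0 G'' < rank0 G].
Proof.
move=> GE dGG'; rewrite {2 4}/rank0; case: (boolP (v0 \in G)) => v0G.
  rewrite /rank0; case: (boolP (v0 \in G')) => v0G'; last by case: ifP.
  by have /pred0P/(_ v0)/= := dGG'; rewrite v0G v0G'.
case: ifP => [/exists_inP[j jG v0j] _|/exists_inPn v0G1 _].
  by exists [set v0; j], j; rewrite !inE /rank0 !inE !eqxx orbT.
have [i [j [GE' ij]]] := edge_ends card_edge GE.
have iG : i \in G by rewrite GE' !inE eqxx.
have v0i : v0 != i by apply: contraNneq v0G => ->.
have [w v0w wi] := diam v0_vertex (adj_vertex ij) v0i (v0G1 i iG).
exists [set w; i], i; split=> //; first by rewrite !inE eqxx orbT.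
rewrite /rank0; case: ifP => // _; case: ifP => // /exists_inPn/(_ w).
by rewrite !inE eqxx v0w => /(_ isT).
Qed.

(* [rank1] orders the components with [b = x_l].  For nonadjacent vertices [l]
   and [l'], the edges at [l'] with [b = x_l] and the edges at [l] with
   [b = x_l'] occur together in one degree complex; sorting both kinds by their
   common neighbour of [l] and [l'] makes the two stars grow together. *)
Definition rank1 G l := if [exists H in E, l \in H]
  then minidx [set j in G | adj E j l] else rank0 G.

(** The order within one degree of [b]. Degrees above 1 matter only for [m >= 3], when [Delta] is a
    matroid and the least vertex suffices. The default 0 never arises, since a monomial of degree 1
    has a variable. *)
Definition level_rank G b := match mdeg b with
  | 0 => rank0 G
  | 1 => if [pick l | 0 < b l] is Some l then rank1 G l else 0
  | _ => minidx G
  end.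

(** Lexicographic order by degree and then by [level_rank], whose values are below [n + 3]. *)
Definition rank G b := mdeg b * n.+3 + level_rank G b.

Lemma level_rank_lt G b : level_rank G b < n.+3.
Proof.
have rank0_lt : rank0 G < n.+3 by rewrite /rank0; case: ifP => // _; case: ifP.
have minidx_lt A : minidx A < n.+3 by move: (minidx_leqn A); clear; lia.
rewrite /level_rank; case: (mdeg b) => [|[|?]] //.
by case: pickP => // l _; rewrite /rank1; case: ifP.
Qed.

Lemma rank_mdeg G G' b b' : mdeg b < mdeg b' -> rank G b < rank G' b'.
Proof.
move=> bb'; have := level_rank_lt G b; rewrite /rank.
have : (mdeg b).+1 * n.+3 <= mdeg b' * n.+3 by rewrite leq_mul2r bb' orbT.
by rewrite mulSn; clear; lia.
Qed.

Lemma rank_mdeg_le G G' b b' : rank G b <= rank G' b' -> mdeg b <= mdeg b'.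
Proof. by apply: contraTT; rewrite -!ltnNge; apply: rank_mdeg. Qed.

Lemma rank_level G G' b b' : mdeg b = mdeg b' ->
  (rank G b < rank G' b') = (level_rank G b < level_rank G' b').
Proof. by rewrite /rank => ->; rewrite ltn_add2l. Qed.

Lemma rank_level_le G G' b b' : mdeg b = mdeg b' ->
  (rank G b <= rank G' b') = (level_rank G b <= level_rank G' b').
Proof. by rewrite /rank => ->; rewrite leq_add2l. Qed.

Lemma level_rank0 G : level_rank G 0%MM = rank0 G.
Proof. by rewrite /level_rank mdeg0. Qed.

Lemma level_rank1 G l : level_rank G U_(l)%MM%MM = rank1 G l.
Proof.
rewrite /level_rank mdeg1; case: pickP => [i|/(_ l)]; rewrite mnm1E ?eqxx //.
by case: eqP => [->|].
Qed.

Lemma rank1_vertex G l : vertex E l ->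
  rank1 G l = minidx [set j in G | adj E j l].
Proof.
by move=> [H HE lH]; rewrite /rank1; case: ifP => // /exists_inPn/(_ H HE);
  rewrite lH.
Qed.

Lemma rank1_nonvertex G l : ~ vertex E l -> rank1 G l = rank0 G.
Proof.
by move=> nl; rewrite /rank1; case: ifP => // /exists_inP[H HE lH]; case: nl;
  exists H.
Qed.

Lemma off_mnm1 G l : off G U_(l)%MM = if l \in G then 0%MM else U_(l)%MM.
Proof.
apply/mnmP => i; rewrite offE mnm1E; case: (eqVneq l i) => [<-|li].
  by case: ifP => _; rewrite ?mnm0E // mnm1E eqxx.
by rewrite if_same; case: ifP => _; rewrite ?mnm0E // mnm1E (negPf li).
Qed.

(** If [l] is on no edge, [b] is [x_l] for every edge and the distance from [v0] decides. Otherwise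
    an edge from [G] to [l] has trivial [b]; failing one, [rank1 G l] is [n], and an edge from [G]
    to a neighbour of [l] ranks lower. *)
Lemma rank_touch_single G G' l : G \in E -> [disjoint G & G'] ->
  G' \in E -> l \notin G -> rank G' (off G' U_(l)%MM) <= rank G U_(l)%MM ->
  exists G'' v, [/\ G'' \in E, v \in G'', v \in G &
    rank G'' (off G'' U_(l)%MM) < rank G U_(l)%MM].
Proof.
move=> GE dGG' G'E lG leR; have [vl|nvl] := pselect (vertex E l); last first.
  have lE H : H \in E -> off H U_(l)%MM = U_(l)%MM.
    by move=> HE; rewrite off_mnm1; case: ifP => // lH; case: nvl; exists H.
  move: leR; rewrite lE // rank_level_le // !level_rank1 !rank1_nonvertex //.
  move=> /(rank0_touch GE dGG')[H [v [HE vH vG ltH]]]; exists H, v; split=> //.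
  by rewrite lE // rank_level // !level_rank1 !rank1_nonvertex.
have [/exists_inP[j jG jl]|/exists_inPn nGl] := boolP [exists j in G, adj E j l].
  exists [set j; l], j; split; rewrite // ?inE ?eqxx //.
  by rewrite off_mnm1 !inE eqxx orbT; apply: rank_mdeg; rewrite mdeg0 mdeg1.
have [i [j [GE' ij]]] := edge_ends card_edge GE.
have iG : i \in G by rewrite GE' !inE eqxx.
have il : i != l by apply: contraNneq lG => <-.
have [w iw wl] := diam (adj_vertex ij) vl il (nGl i iG).
exists [set i; w], i; split; rewrite // ?inE ?eqxx //.
rewrite off_mnm1 !inE ![l == _]eq_sym (negPf il) (negPf (adj_neq card_edge wl)) /=.
rewrite rank_level // !level_rank1 !rank1_vertex //.
have -> : [set u in G | adj E u l] = finset.set0.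
  by apply/setP => u; rewrite !inE; apply/negP => /andP[/nGl/negPf->].
have -> : minidx finset.set0 = n by case: minidxP => // u; rewrite inE.
by apply: leq_ltn_trans (ltn_ord w); apply: minidx_le; rewrite !inE eqxx orbT.
Qed.

(** If [l] and [l'] are adjacent, their edge has trivial [b]. Otherwise, if [G] contains a common
    neighbour of theirs, the rank comparison makes the other end of [G'] one of smaller index; if
    [G] contains none, any common neighbour will do. *)
Lemma rank_touch_pair G G' l l' : G \in E -> [disjoint G & G'] -> G' \in E ->
  l' \in G -> l \in G' -> rank G' U_(l')%MM <= rank G U_(l)%MM ->
  exists G'' v, [/\ G'' \in E, v \in G'', v \in G &
    rank G'' (off G'' (U_(l) + U_(l'))%MM) < rank G U_(l)%MM].
Proof.
move=> GE dGG' G'E l'G lG'.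
have disj v : v \in G -> v \in G' -> False.
  by move=> vG vG'; have /pred0P/(_ v)/= := dGG'; rewrite vG vG'.
have vl : vertex E l by exists G'.
have vl' : vertex E l' by exists G.
rewrite rank_level_le ?mdeg1 // !level_rank1 !rank1_vertex // => leR.
have [adjl|nadj] := boolP (adj E l l').
  exists [set l; l'], l'; split; rewrite // ?inE ?eqxx ?orbT //.
  rewrite offD !off_mnm1 !inE !eqxx orbT add0m.
  by apply: rank_mdeg; rewrite mdeg0 mdeg1.
have ll' : l' != l by apply/eqP => ll'; apply: (disj l); rewrite // -ll'.
suff [x [l'x xl xR]] : exists x, [/\ adj E l' x, adj E x l &
    x < minidx [set j in G | adj E j l]].
  exists [set l'; x], l'; split; rewrite // ?inE ?eqxx //.
  rewrite offD !off_mnm1 !inE eqxx ![l == _]eq_sym (negPf ll') /= addm0.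
  rewrite (negPf (adj_neq card_edge xl)) rank_level // !level_rank1 !rank1_vertex //.
  by apply: leq_ltn_trans xR; apply: minidx_le; rewrite !inE eqxx orbT.
move: leR; case: (minidxP [set j in G | adj E j l]) => [j|_ _]; last first.
  have [|x l'x xl] := diam vl' vl ll'; first by rewrite adj_sym.
  by exists x.
rewrite !inE => /andP[jG jl] _; case: minidxP => [j'|_]; last first.
  by rewrite leqNgt ltn_ord.
rewrite !inE => /andP[j'G' j'l'] _ le_j'j; exists j'; split;
  first by rewrite adj_sym.
  apply: (edge_adj card_edge G'E) => //; apply: contraNneq nadj => <-.
  exact: j'l'.
rewrite ltn_neqAle le_j'j andbT; apply/eqP => /val_inj jj'.
by apply: (disj j'); rewrite // jj'.
Qed.

(** By [dominates], each vertex of either edge has a neighbour in the other, so the bipartite graph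
    between them has a perfect matching. *)
Lemma edge_matching G G' z : 2 < m -> G \in E -> G' \in E -> [disjoint G & G'] ->
  z \in G' -> exists i j y, [/\ G = [set i; j], G' = [set z; y],
    adj E z i & adj E y j].
Proof.
move=> m2 GE G'E dGG' zG'.
have disj v w : v \in G -> w \in G' -> w != v.
  move=> vG wG'; apply/eqP => wv; have /pred0P/(_ v)/= := dGG'.
  by rewrite vG -wv wG'.
have [y G'E' zy] := edge_pair card_edge G'E zG'.
have [i [j [GE' ij]]] := edge_ends card_edge GE.
have yG' : y \in G' by rewrite G'E' !inE eqxx orbT.
have iG : i \in G by rewrite GE' !inE eqxx.
have jG : j \in G by rewrite GE' !inE eqxx orbT.
have vz := adj_vertex zy.
have vy : vertex E y by apply: (@adj_vertex _ _ y z); rewrite adj_sym.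
have vi := adj_vertex ij.
have vj : vertex E j by apply: (@adj_vertex _ _ j i); rewrite adj_sym.
have zD := dominates m2 vz ij (disj _ _ iG zG') (disj _ _ jG zG').
have yD := dominates m2 vy ij (disj _ _ iG yG') (disj _ _ jG yG').
have ne v w : v \in G -> w \in G' -> v != w by move=> *; rewrite eq_sym disj.
have iD := dominates m2 vi zy (ne _ _ iG zG') (ne _ _ iG yG').
have jD := dominates m2 vj zy (ne _ _ jG zG') (ne _ _ jG yG').
rewrite !(adj_sym E _ z) !(adj_sym E _ y) in iD jD.
have GE2 : G = [set j; i] by rewrite finset.setUC.
have [zi|nzi] := boolP (adj E z i).
  have [yj|nyj] := boolP (adj E y j); first by exists i, j, y.
  move: yD jD; rewrite (negPf nyj) !orbF => yi zj.
  by exists j, i, y.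
move: zD iD; rewrite (negPf nzi) /= => zj yi.
by exists j, i, y.
Qed.

Lemma degon_pair a i j : i != j -> degon [set i; j] a = a i + a j.
Proof. by move=> ij; rewrite /degon big_setU1 ?inE // big_set1. Qed.

Lemma degonC G a : degon G a + degon (~: G) a = mdeg a.
Proof.
rewrite mdegE /degon [RHS](bigID (mem G)) /=; congr (_ + _).
by apply: eq_bigl => i; rewrite finset.in_setC.
Qed.

(** The degrees off the matching edges [{z, i}] and [{y, j}] have the same sum as those off [G] and
    [G']. So one of them is smaller than the degree off [G], or all agree and [{z, i}] comes earlier
    because the least vertex [z] of [G'] is below all of [G]. *)
Lemma rank_touch_matroid G G' a : 2 < m -> G \in E -> G' \in E ->
  [disjoint G & G'] -> 1 < mdeg (off G a) ->
  rank G' (off G' a) <= rank G (off G a) ->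
  exists G'' v, [/\ G'' \in E, v \in G'', v \in G &
    rank G'' (off G'' a) < rank G (off G a)].
Proof.
move=> m2 GE G'E dGG' Ga leR.
have [z zG' zmin] : exists2 z, z \in G' & z = minidx G' :> nat.
  case: minidxP => [z zG' _|G'0]; first by exists z.
  by have := card_edge G'E; rewrite G'0 cards0.
have [i [j [y [Gij G'zy zi yj]]]] := edge_matching m2 GE G'E dGG' zG'.
have iG : i \in G by rewrite Gij !inE eqxx.
have jG : j \in G by rewrite Gij !inE eqxx orbT.
have [neij nezy] : i != j /\ z != y.
  by have := card_edge GE; have := card_edge G'E; rewrite Gij G'zy !cards2;
    do 2!case: eqP.
have w1 := degon_pair a (adj_neq card_edge zi).
have w2 := degon_pair a (adj_neq card_edge yj).
have wG := degon_pair a neij; have wG' := degon_pair a nezy.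
rewrite -Gij in wG; rewrite -G'zy in wG'.
have := rank_mdeg_le leR; rewrite !mdeg_off => leD.
have cG := degonC G a; have cG' := degonC G' a.
have c1 := degonC [set z; i] a; have c2 := degonC [set y; j] a.
have [lt1|le1] := ltnP (degon (~: [set z; i]) a) (degon (~: G) a).
  exists [set z; i], i; split; rewrite // ?inE ?eqxx ?orbT //.
  by apply: rank_mdeg; rewrite !mdeg_off.
have [lt2|le2] := ltnP (degon (~: [set y; j]) a) (degon (~: G) a).
  exists [set y; j], j; split; rewrite // ?inE ?eqxx ?orbT //.
  by apply: rank_mdeg; rewrite !mdeg_off.
have [eqD eqD1] : degon (~: G') a = degon (~: G) a /\
    degon (~: [set z; i]) a = degon (~: G) a.
  move: w1 w2 wG wG' cG cG' c1 c2 le1 le2 leD.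
  move: (degon (~: G) a) (degon (~: G') a) (degon (~: [set z; i]) a).
  move: (degon (~: [set y; j]) a) (degon G a) (degon G' a) (degon [set z; i] a).
  move: (degon [set y; j] a) (mdeg a) (a i) (a j) (a y) (a z); clear.
  by move=> *; split; lia.
exists [set z; i], i; split; rewrite // ?inE ?eqxx ?orbT //.
have lvl H : mdeg (off H a) = mdeg (off G a) -> level_rank H (off H a) = minidx H.
  by rewrite /level_rank => ->; case: (mdeg _) Ga => [|[]].
rewrite rank_level ?mdeg_off // !lvl ?mdeg_off //.
move: leR; rewrite rank_level_le ?mdeg_off // !lvl ?mdeg_off // => leM.
have : minidx [set z; i] <= z by apply: minidx_le; rewrite !inE eqxx.
move=> /leq_ltn_trans; apply; rewrite zmin ltn_neqAle leM andbT -zmin.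
apply/eqP; case: minidxP => [u uG _ /val_inj zu|_]; last by have := ltn_ord z; lia.
by have /pred0P/(_ z)/= := dGG'; rewrite zG' zu uG.
Qed.

Lemma rank_shelling G G' a : G \in E -> G' \in E -> [disjoint G & G'] ->
  mdeg (off G a) < m -> rank G' (off G' a) <= rank G (off G a) ->
  exists G'' v, [/\ G'' \in E, v \in G'', v \in G &
    rank G'' (off G'' a) < rank G (off G a)].
Proof.
move=> GE G'E dGG' Gam leR.
have disj v : v \in G -> v \in G' -> False.
  by move=> vG vG'; have /pred0P/(_ v)/= := dGG'; rewrite vG vG'.
have leD := rank_mdeg_le leR.
have [Ga1|] := ltnP 1 (mdeg (off G a)).
  by apply: (rank_touch_matroid _ GE G'E); rewrite // (leq_ltn_trans Ga1).
rewrite leq_eqVlt ltnS leqn0 => /orP[/mdeg1P[l /eqP Gal]|Ga0]; last first.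
  have a0 : a = 0%MM.
    move: leD; rewrite (eqP Ga0) leqn0 mdeg_eq0 => /eqP G'a0.
    move: Ga0; rewrite mdeg_eq0 => /eqP Ga0; apply/mnmP => i; rewrite mnm0E.
    have := congr1 (fun c : 'X_{1..n} => c i) Ga0.
    have := congr1 (fun c : 'X_{1..n} => c i) G'a0.
    rewrite !offE !mnm0E; case: ifP => // iG'; case: ifP => // iG.
    by case: (disj i).
  have off0 H : off H 0%MM = 0%MM.
    by apply/mnmP => i; rewrite offE mnm0E; case: ifP.
  move: leR; rewrite a0 !off0 rank_level_le // !level_rank0.
  move=> /(rank0_touch GE dGG')[H [v [HE vH vG ltH]]]; exists H, v; split=> //.
  by rewrite !off0 rank_level // !level_rank0.
have Gai i : i \notin G -> a i = (l == i).
  move=> iG; have := congr1 (fun c : 'X_{1..n} => c i) Gal.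
  by rewrite offE mnm1E (negPf iG).
have lG : l \notin G.
  apply/negP => lG; have := congr1 (fun c : 'X_{1..n} => c l) Gal.
  by rewrite offE mnm1E lG eqxx.
(* A variable [x_l'] with [l'] in [G] that divides [x^a] is off [G'], so it is all that [x^a] has
   off [G']; this forces [x^a = x_l x_l'] with [l] in [G']. *)
have [/exists_inP[l' l'G al']|/exists_inPn aG0] := boolP [exists i in G, 0 < a i].
  have l'G' : l' \notin G' by apply/negP => /(disj l' l'G).
  have /mdeg1P[l1 /eqP G'al] : mdeg (off G' a) == 1.
    rewrite eqn_leq; move: leD; rewrite Gal mdeg1 => -> /=; rewrite mdeg_off.
    by apply: leq_trans al' (leq_degon _ _); rewrite finset.in_setC.
  have G'ai i : i \notin G' -> a i = (l1 == i).
    move=> iG; have := congr1 (fun c : 'X_{1..n} => c i) G'al.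
    by rewrite offE mnm1E (negPf iG).
  have l1E : l1 = l' by move: al'; rewrite G'ai //; case: eqP.
  rewrite {}l1E in G'al G'ai.
  have lG' : l \in G'.
    apply/negPn/negP => lG'; have := Gai l lG; rewrite eqxx G'ai //.
    by case: eqP => // l'l; move: lG; rewrite -l'l l'G.
  have aE : a = (U_(l) + U_(l'))%MM.
    apply/mnmP => i; rewrite mnmDE !mnm1E.
    have [iG|iG] := boolP (i \in G).
      rewrite G'ai; last by apply/negP => /(disj i iG).
      by case: (eqVneq l i) => // li; rewrite li iG in lG.
    rewrite Gai //; case: (eqVneq l' i) => [l'i|_]; last by rewrite addn0.
    by rewrite -l'i l'G in iG.
  move: leR; rewrite Gal G'al => /(rank_touch_pair GE dGG' G'E l'G lG').
  by rewrite -aE.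
have aE : a = U_(l)%MM.
  apply/mnmP => i; have [iG|/Gai->] := boolP (i \in G); last by rewrite mnm1E.
  have := aG0 i iG; rewrite -eqn0Ngt => /eqP->; rewrite mnm1E.
  by case: eqP => // li; rewrite li iG in lG.
by move: leR; rewrite aE (off_mnm1 G) (negPf lG); apply: rank_touch_single.
Qed.

End ShellingRank.

(** * Dimension and depth *)

Section DimensionTools.
Local Open Scope classical_set_scope.
Context {R : comNzRingType}.
Implicit Types (J M A B P : set R) (f g x : R).

(** A relation modulo [J] whose lexicographically lowest term is [x0^e0 x1^e1 x2^e2], with
    coefficient 1. *)
Definition trailing_relation J x0 x1 x2 := exists e0 e1 e2 c0 c1 c2,
  J (x0 ^+ e0 * (x1 ^+ e1 * (x2 ^+ e2 * (1 + x2 * c2) + x1 * c1) + x0 * c0)).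

Lemma cancelX J x e h : (forall h, J (x * h) -> J h) -> J (x ^+ e * h) -> J h.
Proof.
move=> regx; elim: e => [|e IHe]; first by rewrite mul1r.
by rewrite exprS -mulrA => /regx/IHe.
Qed.

(** The relation is peeled from outside: cancel the power of [x i] modulo [K i], then drop the
    multiple of [x i], which is in [K i.+1]. Chains of primes and regular sequences both provide
    such data, so one argument bounds dimension and depth. *)
Lemma trailing_collapse (K : nat -> set R) (x : nat -> R) :
  (forall i, (i <= 3)%N -> is_ideal (K i)) ->
  (forall i, (i < 3)%N -> [/\ K i `<=` K i.+1, K i.+1 (x i)
     & forall h, K i (x i * h) -> K i h]) ->
  trailing_relation (K 0%N) (x 0%N) (x 1%N) (x 2%N) -> K 3%N 1.
Proof.
move=> idK xK [e0 [e1 [e2 [c0 [c1 [c2]]]]]].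
have step i e h c : (i < 3)%N -> K i (x i ^+ e * (h + x i * c)) -> K i.+1 h.
  move=> i3 /cancelX Kh; have [KS Kx reg] := xK i i3; have idS := idK i.+1 i3.
  by rewrite -(addrK (x i * c) h); apply: (idealB idS);
    [apply/KS/Kh|apply: (idealMr idS)].
by move=> /step/= /(_ isT)/step/= /(_ isT)/step/= /(_ isT).
Qed.

Lemma quot_prime_chain_le2 J :
  (forall x0 x1 x2, trailing_relation J x0 x1 x2) ->
  forall e, quot_prime_chain J e -> (e <= 2)%N.
Proof.
move=> relJ e [P [primeP chainP]]; rewrite leqNgt; apply/negP => e2.
have /choice[x xP] i : exists x, (i < 3)%N -> P i.+1 x /\ ~ P i x.
  case: (ltnP i 3) => i3; last by exists 0.
  have [_ nsub] := chainP i (leq_trans i3 e2).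
  apply: contrapT => nox; apply: nsub => x Px; apply: contrapT => nPx.
  by apply: nox; exists x.
have [_ nP1 _] := (primeP 3%N e2).1; apply: nP1.
apply: (@trailing_collapse P x) => [i i3|i i3|].
- by have [[]] := (primeP i (leq_trans i3 e2)).1.
- have [Px nPx] := xP i i3; split=> //.
    by case: (chainP i (leq_trans i3 e2)).
  move=> h; have [[_ _ PM] _] := primeP i (ltnW (leq_trans i3 e2)).
  by move=> /PM[].
- have [e0 [e1 [e2' [c0 [c1 [c2]]]]]] := relJ (x 0%N) (x 1%N) (x 2%N).
  move=> /(primeP 0%N (leq0n _)).2; by exists e0, e1, e2', c0, c1, c2.
Qed.

Lemma quot_regular_seq_le2 M J s :
  (forall x0 x1 x2, trailing_relation J x0 x1 x2) ->
  quot_regular_seq M J s -> (size s <= 2)%N.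
Proof.
move=> relJ [_ regs ns]; rewrite leqNgt; apply/negP => s2; apply: ns.
pose K i := ideal_gen (J `|` [set` take i s]).
have Ksub i j : (forall y, y \in take i s -> y \in take j s) -> K i `<=` K j.
  move=> sub; apply: ideal_gen_min; first exact: ideal_gen_ideal.
  by move=> y [Jy|/= /sub ys]; apply: sub_ideal_gen; [left|right].
suff : K 3%N 1.
  apply: ideal_gen_min; first exact: ideal_gen_ideal.
  by move=> y [Jy|/= /mem_take ys]; apply: sub_ideal_gen; [left|right].
apply: (@trailing_collapse K (nth 0 s)) => [i _|i i3|].
- exact: ideal_gen_ideal.
- have iS := leq_trans i3 s2; split.
  + by apply: Ksub => y; rewrite (take_nth 0) // mem_rcons inE orbC => ->.
  + by apply: sub_ideal_gen; right; rewrite /= (take_nth 0) // mem_rcons inE eqxx.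
  + exact: regs.
- have [e0 [e1 [e2 [c0 [c1 [c2 Jr]]]]]] := relJ s`_0 s`_1 s`_2.
  by exists e0, e1, e2, c0, c1, c2; apply: sub_ideal_gen; left.
Qed.

(** The depth lemma for [0 -> B/A -> R/A -> R/B -> 0], with [B/A] isomorphic to [R/P]. *)
Lemma regular_pair_extension A B P f g : is_ideal A -> is_ideal B -> is_ideal P ->
  A `<=` B -> subquot_iso B A setT P ->
  regular_pair P f g -> regular_pair B f g -> regular_pair A f g.
Proof.
move=> iA iB iP AB [phi [_ phiD phiM phiA phisurj]] [Pf Pg] [Bf Bg].
have phiB x y : B x -> B y -> P (phi x) -> P (phi (x + y)) -> P (phi y).
  move=> Bx By Px Pxy; have := idealB iP (idealB iP Pxy (phiD _ _ Bx By)) Px.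
  by congr P; ring.
split=> [h Afh|h t Agh].
  have Bh := Bf h (AB _ Afh); apply/(phiA _ Bh)/Pf.
  by apply: (ideal_subKr iP (phiM f h Bh)); apply/phiA => //; apply: idealMl.
(* Regularity on [R / B] gives [h = t1 f] modulo [B]. The remainders [h1] and [t2] lie in [B], so
   the relation between them passes to [R / P] through [phi], and [w] lifts the quotient [t3] found
   there. *)
have [t1 Bh1] := Bg _ _ (AB _ Agh); set h1 := h - t1 * f in Bh1.
pose t2 := t - g * t1.
have Agh1 : A (g * h1 - t2 * f) by move: Agh; congr A; rewrite /h1 /t2; ring.
have Bt2 : B t2.
  apply: Bf; have := idealB iB (idealMl iB g Bh1) (AB _ Agh1).
  by congr B; ring.
have Bft := idealMl iB (- f) Bt2.
have Bgh := idealMl iB g Bh1.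
have : P (g * phi h1 - phi t2 * f).
  have PS : P (phi (g * h1 + - f * t2)).
    apply/phiA; first exact: idealD.
    by move: Agh1; congr A; ring.
  have := idealB iP PS (idealD iP (idealD iP (phiD _ _ Bgh Bft) (phiM g h1 Bh1))
    (phiM (- f) t2 Bt2)).
  by congr P; ring.
move=> /Pg[t3 Pt3]; have [w Bw Pw] := phisurj t3 I.
exists (t1 + w); have Bfw := idealMl iB (- f) Bw.
suff : A (h1 + - f * w) by congr A; rewrite /h1; ring.
apply/phiA; first exact: idealD.
have := idealD iP (idealD iP (idealD iP Pt3 (phiD _ _ Bh1 Bfw)) (phiM (- f) w Bw))
  (idealMr iP f Pw).
by congr P; ring.
Qed.

Lemma regular_pair_seq M J f g : is_ideal J -> M f -> M g ->
  regular_pair J f g -> ~ ideal_gen (J `|` [set` [:: f; g]]) 1 ->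
  quot_regular_seq M J [:: f; g].
Proof.
move=> iJ Mf Mg [regf regg] n1; split=> // [h|].
  by rewrite !inE => /orP[]/eqP->.
case=> [|[|i]] // _ h.
  by rewrite take0 ideal_adjoin0 // => /regf.
have -> : take 1 [:: f; g] = [:: f] by [].
by move=> /(ideal_adjoinP iJ)[t /regg ?]; apply/(ideal_adjoinP iJ).
Qed.

(** [e] is the least index that [z] does not certify as zero; factoring out [x ^+ e] leaves [c e]
    plus a multiple of [x]. *)
Lemma sum_trailing N (c : 'I_N -> R) (z : pred 'I_N) x :
  (forall i, z i -> c i = 0) -> (exists i, ~~ z i) ->
  exists2 e, ~~ z e & exists r, \sum_i c i * x ^+ i = x ^+ e * (c e + x * r).
Proof.
move=> cz [i0 zi0]; have [e ze emin] := arg_minnP (P := fun i =>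
  ~~ z i) (fun i : 'I_N => val i) zi0.
exists e => //; exists (\sum_(i < N | i != e) c i * x ^+ (i - e).-1).
rewrite (bigD1 e) //= mulrDr [c e * _]mulrC; congr (_ + _).
rewrite mulrA -exprSr big_distrr; apply: eq_bigr => i ie /=.
have [zi|zi] := boolP (z i); first by rewrite cz // !mul0r mulr0.
have ei : (e < i)%N by rewrite ltn_neqAle emin // andbT eq_sym.
rewrite mulrCA -exprD; congr (_ * _ ^+ _); move: ei; clear; lia.
Qed.

End DimensionTools.

(** * Counting monomials outside the symbolic power *)

Section Counting.
Local Open Scope set_scope.
Context {k : fieldType} {n : nat}.
Local Notation S := {mpoly k[n]}.

(** Modulo [mideal U] only the coefficients at the monomials [mon t] count, and a matrix with more
    rows than columns has a nonzero left kernel. *)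
Lemma linear_relation (I T : finType) (U : set 'X_{1..n}) (mon : T -> 'X_{1..n})
    (h : I -> S) : (#|T| < #|I|)%N ->
  (forall p a, a \in msupp (h p) -> ~ U a -> exists t, a = mon t) ->
  exists2 v : I -> k, exists p, v p != 0 & mideal U (\sum_p v p *: h p).
Proof.
move=> ltTI hU.
pose M := \matrix_(p < #|I|, t < #|T|) (h (enum_val p))@_(mon (enum_val t)).
have : kermx M != 0.
  rewrite kermx_eq0 /row_free; apply: contraTneq ltTI => <-.
  by rewrite -leqNgt rank_leq_col.
move=> /rowV0Pn[v /sub_kermxP vM v0].
exists (fun p => v 0 (enum_rank p)).
  have /rV0Pn[i vi] : v != 0 by [].
  by exists (enum_val i); rewrite enum_valK.
move=> a; rewrite mcoeff_msupp linear_sum /= => ha; apply: contrapT => Ua.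
have [[p /hU/(_ Ua)[t at_]]|noa] := pselect (exists p, a \in msupp (h p)).
  move/eqP: ha; apply; have := congr1 (fun w : 'rV_(#|T|) => w 0 (enum_rank t)) vM.
  rewrite !mxE; apply: etrans; rewrite [RHS](reindex_onto enum_rank enum_val)
    /=; last first.
    by move=> i _; rewrite enum_valK.
  apply: eq_big => [q|q _]; first by rewrite enum_rankK eqxx.
  by rewrite linearZ /= !mxE !enum_rankK at_.
move/eqP: ha; apply; apply: big1 => p _; rewrite linearZ /= memN_msupp_eq0 ?mulr0 //.
by apply/negP => ap; apply: noa; exists p.
Qed.

Definition degree_le d (f : S) := forall a, a \in msupp f -> (mdeg a <= d)%N.

Lemma degree_leM d e f g : degree_le d f -> degree_le e g ->
  degree_le (d + e) (f * g).
Proof.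
move=> df eg a /msuppM_le/allpairsP[[b c] /= [/df bd /eg ce ->]].
by rewrite mdegD leq_add.
Qed.

Lemma degree_leX d f i : degree_le d f -> degree_le (d * i) (f ^+ i).
Proof.
move=> df; elim: i => [a|i IHi]; last by rewrite exprS mulnS; apply: degree_leM.
by rewrite expr0 msupp1 inE => /eqP->; rewrite mdeg0.
Qed.

Lemma degree_le_leq d e f : (d <= e)%N -> degree_le d f -> degree_le e f.
Proof. by move=> de df a /df/leq_trans; apply. Qed.

Variables (E : {set {set 'I_n}}) (m : nat).
Hypothesis card_edge : forall G, G \in E -> #|G| = 2%N.
Hypothesis m_gt0 : (0 < m)%N.

(* Outside some edge [{v, w}] the exponents of a monomial not in the symbolic
   power are less than [m], so there are only [O(D ^ 2)] such monomials in
   degree at most [D]. *)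
Definition strip_monomial D
    (t : 'I_n * 'I_n * {ffun 'I_n -> 'I_m} * 'I_D.+1 * 'I_D.+1) : 'X_{1..n} :=
  let: (v, w, b, x, y) := t in
  [multinom (if i == v then x : nat else if i == w then y : nat else b i) | i < n].

Lemma strip_monomialP D a : (mdeg a <= D)%N -> ~ symb E m a ->
  exists t, a = @strip_monomial D t.
Proof.
move=> aD nEa.
have [G GE Ga] : exists2 G, G \in E & (degon (~: G) a < m)%N.
  apply: contrapT => noG; apply: nEa => G GE; rewrite leqNgt; apply/negP => Ga.
  by apply: noG; exists G.
have [v [w [GE' vw]]] := edge_ends card_edge GE.
have aiD i : (a i < D.+1)%N by rewrite ltnS (leq_trans _ aD) // mdegE (bigD1 i)
  //= leq_addr.
pose b : {ffun 'I_n -> 'I_m} := [ffun i => insubd (Ordinal m_gt0) (a i)].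
exists (v, w, b, Ordinal (aiD v), Ordinal (aiD w)).
apply/mnmP => i; rewrite mnmE /=; case: (eqVneq i v) => [->//|iv].
case: (eqVneq i w) => [->//|iw]; rewrite ffunE val_insubd ifT //.
apply: leq_ltn_trans Ga; apply: leq_degon.
by rewrite finset.in_setC GE' !inE negb_or iv.
Qed.

Lemma symbolic_trailing_relation (x0 x1 x2 : S) :
  trailing_relation (mideal (symb E m)) x0 x1 x2.
Proof.
pose d := (msize x0 + msize x1 + msize x2)%N.
have xd x : (msize x <= d)%N -> degree_le d x.
  by move=> xd a /msize_mdeg_lt/ltnW/leq_trans; apply.
have [x0d x1d x2d] : [/\ degree_le d x0, degree_le d x1 & degree_le d x2].
  by split; apply: xd; rewrite /d; clear; lia.
(* [c] counts the choices of [(v, w, b)], and [D] bounds the degree of the [N^3] products [h p]. As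
   [D + 1 <= N (3 d + 1)], there are at most [c (3 d + 1)^2 N^2 = (N - 1) N^2 < N^3] strip
   monomials. *)
pose c := (n * n * m ^ n)%N; pose N := (c * (3 * d + 1) ^ 2).+1.
pose D := (3 * d * N)%N.
pose h (p : 'I_N * 'I_N * 'I_N) : S := x2 ^+ p.2 * x1 ^+ p.1.2 * x0 ^+ p.1.1.
have hD p : degree_le D (h p).
  apply: (@degree_le_leq (d * p.2 + d * p.1.2 + d * p.1.1)%N); last first.
    by apply: degree_leM; last exact: degree_leX; apply: degree_leM;
      apply: degree_leX.
  rewrite -!mulnDr /D [(3 * d)%N]mulnC -mulnA leq_mul2l.
  case: p => -[i j] l /=; have := ltn_ord i; have := ltn_ord j; have := ltn_ord l.
  move: (N) (i : nat) (j : nat) (l : nat); clear; move=> *; apply/orP; right; lia.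
have [||v [[[p1 p2] p3] vp] Jh] := @linear_relation _ _ (symb E m)
  (@strip_monomial D) h.
- rewrite !card_prod !card_ord card_ffun !card_ord.
  have leD : (D.+1 <= N * (3 * d + 1))%N by rewrite /D /N; clear; nia.
  have lt1 : (c * D.+1 * D.+1 <= c * (N * (3 * d + 1)) * (N * (3 * d + 1)))%N.
    by rewrite !leq_mul.
  apply: leq_ltn_trans lt1 _.
  have -> : (c * (N * (3 * d + 1)) * (N * (3 * d + 1)) = N.-1 * (N * N))%N.
    by rewrite /N /=; clear; ring.
  by rewrite -mulnA ltn_pmul2r // muln_gt0.
- by move=> p a /hD; apply: strip_monomialP.
(* The relation is read as a polynomial in [x0] over polynomials in [x1] over polynomials in [x2];
   lowest terms taken level by level give the lexicographically lowest one. *)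
pose d2 i j := \sum_l (v (i, j, l))%:MP * x2 ^+ l.
pose d1 i := \sum_j d2 i j * x1 ^+ j.
have {Jh} : mideal (symb E m) (\sum_i d1 i * x0 ^+ i).
  move: Jh; congr mideal; transitivity (\sum_i \sum_j \sum_l v (i, j, l) *:
    h (i, j, l)).
    rewrite (pair_bigA _ (fun i j => \sum_l v (i, j, l) *: h (i, j, l))).
    rewrite (pair_bigA _ (fun q l => v (q.1, q.2, l) *: h (q.1, q.2, l))).
    by apply: eq_bigr => -[[i j] l].
  apply: eq_bigr => i _; rewrite big_distrl; apply: eq_bigr => j _ /=.
  rewrite !big_distrl; apply: eq_bigr => l _ /=.
  by rewrite -mul_mpolyC /h !mulrA.
have [||e0 z0 [r0 ->]] := @sum_trailing _ _ d1
  (fun i => [forall j, forall l, v (i, j, l) == 0]) x0.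
- move=> i /forallP vi; rewrite /d1 big1 // => j _;
  rewrite /d2 big1 ?mul0r // => l _.
  by rewrite (eqP (forallP (vi j) l)) mul0r.
- by exists p1; apply/forallPn; exists p2; apply/forallPn; exists p3.
have [||e1 z1 [r1 E1]] := @sum_trailing _ _ (d2 e0)
  (fun j => [forall l, v (e0, j, l) == 0]) x1.
- move=> j /forallP vj; rewrite /d2 big1 // => l _; by rewrite (eqP (vj l)) mul0r.
- by move/forallPn: z0.
have [||e2 z2 [r2 E2]] := @sum_trailing _ _ (fun l => (v (e0, e1, l))%:MP : S)
  (fun l => v (e0, e1, l) == 0) x2.
- by move=> l /eqP->.
- by move/forallPn: z1.
rewrite [d1 e0]E1 [d2 e0 e1]E2; set u := v (e0, e1, e2) in z2 *.
(* Dividing by the coefficient [u] of the lowest term makes it 1. *)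
have uV : (u^-1)%:MP * u%:MP = 1 :> S by rewrite -mpolyCM mulVf.
move=> /(idealMl (mideal_ideal (@symb_up _ E m)) (u^-1)%:MP) Jr.
exists e0, e1, e2, ((u^-1)%:MP * r0), ((u^-1)%:MP * r1), ((u^-1)%:MP * r2).
by move: Jr; congr mideal; rewrite -uV; ring.
Qed.

End Counting.

(** * A regular pair common to all edges *)

Section RegularParams.
Local Open Scope set_scope.
Context {k : fieldType} {n : nat}.
Local Notation S := {mpoly k[n]}.

(** The elementary symmetric polynomials [e_1] and, next, [e_2]. Modulo [P_(~: {i, j})] they become
    [x_i + x_j] and [x_i x_j], so one pair serves all edges at once. *)
Definition var_sum : S := \sum_i 'X_i.
Definition var_sum2 : S := \sum_(p : 'I_n * 'I_n | (p.1 < p.2)%N) 'X_p.1 * 'X_p.2.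

Lemma var_sum_max : var_ideal [set: 'I_n] var_sum.
Proof.
apply: (ideal_sum (var_ideal_ideal _)) => i _; apply: sub_ideal_gen.
by exists i; rewrite //= inE.
Qed.

Lemma var_sum2_max : var_ideal [set: 'I_n] var_sum2.
Proof.
apply: (ideal_sum (var_ideal_ideal _)) => p _.
apply: (idealMl (var_ideal_ideal _)); apply: sub_ideal_gen.
by exists p.2; rewrite //= inE.
Qed.

Section Edge.
Variables i j : 'I_n.
Hypothesis lt_ij : (i < j)%N.
Local Notation P := (var_ideal (~: [set i; j]) : set S).

Let P_ideal : is_ideal P := var_ideal_ideal _.

Lemma edge_ideal_var l : l != i -> l != j -> P 'X_l.
Proof.
move=> li lj; apply: sub_ideal_gen; exists l => //=.
by rewrite finset.in_setC !inE negb_or li.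
Qed.

Lemma neq_ij : j != i.
Proof. by rewrite neq_ltn lt_ij orbT. Qed.

Lemma var_sum_edge : P (var_sum - ('X_i + 'X_j)).
Proof.
rewrite /var_sum (bigD1 i) //= (bigD1 j) ?neq_ij //= addrA [X in X - _]addrC addrK.
by apply: (ideal_sum P_ideal) => l /andP[li lj]; apply: edge_ideal_var.
Qed.

Lemma var_sum2_edge : P (var_sum2 - 'X_i * 'X_j).
Proof.
rewrite /var_sum2 (bigD1 (i, j)) //= [X in X - _]addrC addrK.
apply: (ideal_sum P_ideal) => -[v w] /= /andP[vw]; rewrite xpair_eqE => nvw.
have [vij|vij] := boolP ((v != i) && (v != j)).
  by apply: (idealMr P_ideal); case/andP: vij; apply: edge_ideal_var.
apply: (idealMl P_ideal); apply: edge_ideal_var.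
  apply: contraNneq vij => wi; rewrite wi in vw; rewrite -!(inj_eq val_inj) /=.
  by move: vw lt_ij; clear; lia.
apply: contraNneq vij => wj; rewrite wj eqxx andbT in nvw.
by rewrite nvw -(inj_eq val_inj) /= neq_ltn -{1}wj vw.
Qed.

(* Setting [x_i = - x_j] and the other variables to [0] presents the quotient
   by [P + (var_sum)] as a subring of [S]. *)
Definition antidiag (f : S) : S :=
  f \mPo [tuple (if l == i then - 'X_j else if l == j then 'X_j else 0) | l < n].

Lemma antidiagX l : antidiag 'X_l =
  if l == i then - 'X_j else if l == j then 'X_j else 0.
Proof. by rewrite /antidiag comp_mpolyXU -tnth_nth tnth_mktuple. Qed.

Lemma antidiag_edge_ideal f : P f -> antidiag f = 0.
Proof.
move: f; apply: ideal_gen_min.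
  split=> [|f g /= f0 g0|r f /= f0]; first exact: rmorph0.
    by rewrite /antidiag rmorphD /= -!/(antidiag _) f0 g0 addr0.
  by rewrite /antidiag rmorphM /= -!/(antidiag _) f0 mulr0.
move=> _ [l /= lij <-]; rewrite antidiagX.
by move: lij; rewrite finset.in_setC !inE negb_or => /andP[/negPf-> /negPf->].
Qed.

Lemma antidiag_var_sum : antidiag var_sum = 0.
Proof.
have := antidiag_edge_ideal var_sum_edge; rewrite /antidiag rmorphB rmorphD /=.
rewrite -!/(antidiag _) !antidiagX !eqxx (negPf neq_ij) addNr subr0.
exact.
Qed.

Lemma antidiag_var_sum2 : antidiag var_sum2 != 0.
Proof.
have := antidiag_edge_ideal var_sum2_edge; rewrite /antidiag rmorphB rmorphM /=.
rewrite -!/(antidiag _) !antidiagX !eqxx (negPf neq_ij) => /eqP.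
rewrite subr_eq0 => /eqP->; rewrite mulf_neq0 ?oppr_eq0 // -msupp_eq0 msuppX //.
Qed.

(** Modulo [P + (e_1)] one has [x_i = - x_j] and the variables off the edge vanish, so every [h] is
    congruent to [antidiag h]; it is enough to see this on variables. *)
Lemma antidiag_ker f : antidiag f = 0 <-> exists t, P (f - t * var_sum).
Proof.
split=> [f0|[t /antidiag_edge_ideal]]; last first.
  rewrite /antidiag rmorphB rmorphM /= -!/(antidiag _).
  by rewrite antidiag_var_sum mulr0 subr0.
pose K : set S := [set h | exists t, P (h - t * var_sum)]%classic.
have iK : is_ideal K := ideal_adjoin_ideal P_ideal _.
have PK h : P h -> K h by exists 0; rewrite mul0r subr0.
suff KX h : K (h - antidiag h) by have := KX f; rewrite f0 subr0.
have KM x y x' y' : K (x - x') -> K (y - y') -> K (x * y - x' * y').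
  move=> Kx Ky; have := idealD iK (idealMl iK y Kx) (idealMl iK x' Ky).
  by congr K; ring.
have Kvar l : K ('X_l - antidiag 'X_l).
  rewrite antidiagX; case: (eqVneq l i) => [->|li].
    rewrite opprK; exists 1; rewrite mul1r -opprB; apply: (idealN P_ideal).
    exact: var_sum_edge.
  case: (eqVneq l j) => [->|lj]; first by rewrite subrr; apply: (ideal0 iK).
  by rewrite subr0; apply: PK; apply: edge_ideal_var.
have Kmon a : K ('X_[a] - antidiag 'X_[a]).
  rewrite mpolyXE_id /antidiag rmorph_prod; apply: (big_rec2 (fun x y => K (x - y))).
    by rewrite subrr; apply: (ideal0 iK).
  move=> l x y _ Kxy; apply: (KM _ _ _ _ _ Kxy); rewrite rmorphXn /= -/(antidiag _).
  elim: (a l) => [|e IHe]; first by rewrite subrr; apply: (ideal0 iK).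
  by rewrite !exprS; apply: KM.
rewrite (mpolyE h) /antidiag [X in _ - X]linear_sum -sumrB.
apply: (ideal_sum iK) => a _; rewrite linearZ /= -scalerBr -mul_mpolyC.
exact: (idealMl iK).
Qed.

(** [e_1] is outside the prime [P]; modulo [e_1], multiplication by [e_2] becomes multiplication by
    [- x_j^2] in the domain [S]. *)
Lemma regular_pair_edge : regular_pair P var_sum var_sum2.
Proof.
have [_ _ PM] := var_ideal_prime (k := k) (~: [set i; j]).
split=> [h /PM[Pf|//]|h t Pgh].
  have := ideal_subKr P_ideal var_sum_edge Pf; rewrite var_idealE.
  move=> /(@mideal_coef0 _ _ _ _ U_(i)%MM).
  rewrite /= degon1 finset.in_setC !inE eqxx mcoeffD !mcoeffXU eqxx (negPf
    neq_ij) addr0.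
  by move=> /(_ notF)/eqP; rewrite oner_eq0.
apply/antidiag_ker; have /antidiag_ker/eqP :
  exists t, P (var_sum2 * h - t * var_sum).
  by exists t.
rewrite /antidiag rmorphM /= -!/(antidiag _) mulf_eq0 (negPf antidiag_var_sum2).
by move=> /eqP.
Qed.

End Edge.
End RegularParams.

(** * Clean filtrations and Cohen-Macaulayness for the symbolic power *)

Section CleanCohenMacaulay.
Local Open Scope set_scope.
Context {k : fieldType} {n : nat}.
Local Notation S := {mpoly k[n]}.
Variables (E : {set {set 'I_n}}) (m : nat).
Hypothesis card_edge : forall G, G \in E -> #|G| = 2%N.
Hypothesis m_gt0 : (0 < m)%N.
Local Notation J := (mideal (symb E m) : set S).

Lemma edge_prime_regular_pair G : G \in E ->
  regular_pair (var_ideal (~: G) : set S) var_sum var_sum2.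
Proof.
move=> /(edge_ends card_edge)[v [w [-> /(adj_neq card_edge)]]].
rewrite neq_ltn => /orP[vw|wv]; first exact: regular_pair_edge.
by rewrite finset.setUC; apply: regular_pair_edge.
Qed.

Lemma clean_cohen_macaulay r (C p : nat -> set S) : (exists G, G \in E) ->
  prime_filtration J r C p ->
  (forall i, (i < r)%N -> exists2 G, G \in E & p i = var_ideal (~: G)) ->
  quot_cohen_macaulay J.
Proof.
move=> [G0 G0E] [C0 Cr Cmon Cp] pE.
have iC i : (i <= r)%N -> is_ideal (C i).
  by move=> /Cmon[A ->]; apply: ideal_gen_ideal.
(* Downwards from [C r = S], where the pair is trivially regular, one factor [S / P_(~: G)] at a
   time. *)
have regC i : (i <= r)%N -> regular_pair (C (r - i)%N) var_sum var_sum2.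
  elim: i => [|i IHi] ir; first by rewrite subn0 Cr; split=> // h t _; exists 0.
  have ri : (r - i.+1 < r)%N by move: ir; clear; lia.
  have [sub _ _ iso] := Cp _ ri; have [G GE pG] := pE _ ri.
  have rS : (r - i.+1).+1 = (r - i)%N by move: ir; clear; lia.
  rewrite rS in sub iso; rewrite pG in iso.
  apply: (regular_pair_extension _ _ _ sub iso).
  - exact/iC/ltnW.
  - exact/iC/leq_subr.
  - exact: var_ideal_ideal.
  - exact: edge_prime_regular_pair.
  - exact/IHi/ltnW.
have JG : (J `<=` (var_ideal (~: G0) : set S))%classic.
  move=> f Jf; rewrite var_idealE => a /Jf/(_ G0 G0E).
  exact: leq_trans.
have rel := symbolic_trailing_relation (k := k) card_edge m_gt0.
exists 2%N; split.
  by split; [apply: edge_chain G0E JG|apply: quot_prime_chain_le2].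
split; last by move=> s; apply: quot_regular_seq_le2.
exists [:: var_sum; var_sum2] => //; apply: regular_pair_seq.
- exact/mideal_ideal/symb_up.
- exact: var_sum_max.
- exact: var_sum2_max.
- by rewrite -C0 -(subnn r); apply: regC.
have [_ max1 _] := var_ideal_prime (k := k) [set: 'I_n] => J1; apply: max1.
move: J1; apply: ideal_gen_min; first exact: var_ideal_ideal.
have GT : (var_ideal (~: G0) `<=` (var_ideal [set: 'I_n] : set S))%classic.
  by apply/var_ideal_subset; apply: finset.subsetT.
move=> f [/JG/GT//|/=].
by rewrite !inE => /orP[]/eqP->; [apply: var_sum_max|apply: var_sum2_max].
Qed.

Lemma cohen_macaulay_filtration : (1 < m)%N -> (exists G, G \in E) ->
  quot_cohen_macaulay J -> exists r (C p : nat -> set S),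
  prime_filtration J r C p /\
  [set p i | i in [set i | (i < r)%N]]%classic =
    [set var_ideal (~: G) | G in [set` E]]%classic.
Proof.
move=> m1 [G GE] CM.
have JG : (J `<=` (var_ideal (~: G) : set S))%classic.
  move=> f Jf; rewrite var_idealE => a /Jf/(_ G GE) /=.
  exact: leq_trans.
have iJ := mideal_ideal (k := k) (@symb_up n E m).
have [f [g [mf mg reg]]] := cohen_macaulay_regular_pair card_edge iJ GE JG CM.
(* Any vertex can serve as the root of the distance order. *)
have [v0 [w [_ /adj_vertex v0w]]] := edge_ends card_edge GE.
apply: (@shelling_filtration _ _ _ _ card_edge (rank E v0)) => //.
  exact: rank_mdeg.
apply: rank_shelling => //.
- by move=> i l; apply: (common_neighbour card_edge mf mg reg m1).
- by move=> m2 i j l; apply: (edge_dominates card_edge mf mg reg m2).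
Qed.

End CleanCohenMacaulay.

Theorem corollary3p3 (k : fieldType) (n m : nat) (Delta : {set {set 'I_n}})
    (m_gt1 : (1 < m)%N)
    (Delta_complex : simplicial_complex Delta)
    (Delta_pure : pure_complex Delta)
    (Delta_dim : complex_dim Delta = 1) :
  (quot_clean (symbolic_power k Delta m) <->
   quot_cohen_macaulay (symbolic_power k Delta m)) /\
  (quot_clean (ideal_pow (stanley_reisner k Delta) m) <->
   quot_cohen_macaulay (ideal_pow (stanley_reisner k Delta) m)).
Proof.
have card_edge := card_facet Delta_pure Delta_dim.
have exE := facet_exists Delta_dim; have m0 := ltnW m_gt1.
have minE : min_primes (mideal (symb (facets Delta) m) : set {mpoly k[n]}) =
    [set var_ideal (~: G) | G in [set` facets Delta]]%classic.
  by apply: min_primesE m0 _ _ => //; apply: ordinary_sub_symbolic.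
have symbP : quot_clean (symbolic_power k Delta m) <->
    quot_cohen_macaulay (symbolic_power k Delta m).
  rewrite symbolic_powerE; split=> [[r [C [p [filt]]]]|CM].
    rewrite minE => suppp; apply: (clean_cohen_macaulay card_edge m0 exE filt).
    move=> i ir; have : [set p i | i in [set i | (i < r)%N]]%classic (p i) by
      exists i.
    by rewrite suppp => -[G GE <-]; exists G.
  by have [r [C [p]]] := cohen_macaulay_filtration card_edge m0 m_gt1 exE CM;
    exists r, C, p; rewrite minE.
(* Either property of [S / I^m] forces [I^m = I^(m)], which reduces the second equivalence to the
   first. *)
split=> //; suff ordE : quot_clean (ideal_pow (stanley_reisner k Delta) m) \/
    quot_cohen_macaulay (ideal_pow (stanley_reisner k Delta) m) ->
    ideal_pow (stanley_reisner k Delta) m = symbolic_power k Delta m.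
  split=> [clean|CM].
    by move: (clean); rewrite (ordE (or_introl clean)) => /symbP.
  by move: (CM); rewrite (ordE (or_intror CM)) => /symbP.
case=> [clean|]; rewrite ordinary_powerE // symbolic_powerE.
  by congr mideal; apply: clean_ordinary_eq_symbolic clean.
have [G GE] := exE => CM.
have iI := mideal_ideal (k := k) (ordpow_up (Delta := Delta) (m := m)).
have IG : (mideal (ordpow Delta m) `<=` (var_ideal (~: G) :
  set {mpoly k[n]}))%classic.
  apply: subset_trans (power_sub_facet m0 GE).
  exact: ordinary_sub_symbolic.
have [f [g [mf mg reg]]] := cohen_macaulay_regular_pair card_edge iI GE IG CM.
by congr mideal; apply: (regular_pair_ordinary_eq_symbolic _ card_edge exE mf
  mg reg).
Qed.
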